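(* Let $d\ge 1$, let $W\subset\mathbb{R}^d$ be a compact convex window, let $\Lambda$ be a locally finite non-atomic measure on the space $\mathcal{H}$ of affine hyperplanes of $\mathbb{R}^d$, and let $t>0$. Let $Y(t,W)$ be the random tessellation of $W$ obtained from the MNW-construction driven by $\Lambda$ up to time $t$, and let $\mathrm{PHT}(t\Lambda,W)$ be the Poisson hyperplane tessellation with intensity measure $t\Lambda$ restricted to $W$. Put $$\mathbb{M}^{Y(t,W)}:=\mathbb{E}\sum_{c\in\mathrm{Cells}(Y(t,W))}\delta_c,\qquad \mathbb{M}^{\mathrm{PHT}(t\Lambda,W)}:=\mathbb{E}\sum_{c\in\mathrm{Cells}(\mathrm{PHT}(t\Lambda,W))}\delta_c .$$ Then $$\mathbb{M}^{Y(t,W)}=\mathbb{M}^{\mathrm{PHT}(t\Lambda,W)} .$$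
   Context: For $B\subset\mathbb{R}^d$ write $[B]:=\{H\in\mathcal{H}: H\cap B\ne\emptyset\}$. A measure $\Lambda$ on $\mathcal{H}$ is locally finite if $\Lambda([B])<\infty$ for all bounded $B$. MNW-construction of $Y(t,W)$: at time $0$ there is a single cell $W$. Every cell $c$ present is given, independently, an exponentially distributed lifetime with parameter $\Lambda([c])$. When the lifetime of $c$ expires, $c$ is split into two sub-cells $c^+,c^-$ by a random hyperplane $H\in[c]$ chosen with law $\Lambda(\cdot\cap[c])/\Lambda([c])$; the new cells receive independent exponential lifetimes with parameters $\Lambda([c^\pm])$, and so on. The construction is stopped at the deterministic time $t$; $Y(t,W)$ is the resulting tessellation of $W$ and $\mathrm{Cells}(Y(t,W))$ is the set of its cells. $\mathrm{PHT}(t\Lambda,W)$ is the tessellation of $W$ into the cells cut out by the hyperplanes of a Poisson process on $\mathcal{H}$ with intensity measure $t\Lambda$. Here $\delta_c$ is the unit Dirac mass at $c$, and $\mathbb{M}^{\cdot}$ are measures on the space of polyhedral cells contained in $W$ (possibly chopped off by the boundary of $W$) with the Borel $\sigma$-algebra inherited from the space of closed subsets of $W$ (Fell topology). *)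

(* Defs.v *)
From HB Require Import structures.
From mathcomp Require Import all_boot all_order all_algebra.
From mathcomp Require Import all_classical all_reals all_analysis.
From mathcomp Require Import measurable_realfun.

Set Implicit Arguments.
Unset Strict Implicit.
Unset Printing Implicit Defensive.

Import Order.TTheory GRing.Theory Num.Theory.
Import numFieldNormedType.Exports.

Local Open Scope classical_set_scope.
Local Open Scope ring_scope.

Record closed_subset (T : topologicalType) := ClosedSubset {
  cset :> set T;
  cset_closed : closed cset }.

Section fell_topology.
Variable T : topologicalType.

HB.instance Definition _ := gen_eqMixin (closed_subset T).
HB.instance Definition _ := gen_choiceMixin (closed_subset T).
HB.instance Definition _ :=
  isPointed.Build (closed_subset T) (ClosedSubset (@closed0 T)).

(* Subbase of the Fell topology, indexed by bool * set T:
   (true, K) with K compact is "misses K", (false, G) with G open is "hits G". *)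
HB.instance Definition _ := @isSubBaseTopological.Build (closed_subset T)
  (bool * set T)%type
  [set i | if i.1 then compact i.2 else open i.2]
  (fun i => if i.1 then [set F | cset F `&` i.2 = set0]
            else [set F | cset F `&` i.2 !=set0]).

End fell_topology.

(* The closed subsets of T with the Borel sigma-algebra of the Fell topology. *)
Definition fell (T : topologicalType) : Type :=
  g_sigma_algebraType (@open (closed_subset T)).

HB.instance Definition _ (T : topologicalType) :=
  Measurable.copy (fell T)
    (g_sigma_algebraType (@open (closed_subset T))).

Definition dotv (R : realType) (n : nat) (u x : 'rV[R]_n) : R :=
  \sum_(i < n) u ord0 i * x ord0 i.

Definition plane (R : realType) (n : nat) (u : 'rV[R]_n) (r : R) :
    set 'rV[R]_n := [set x | dotv u x = r].

(* Affine hyperplanes of R^d.  The dimension is d.+1 >= 1 throughout: R^0 has no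
   hyperplane, while a measurable type has to be inhabited. *)
Record hyperplane (R : realType) (d : nat) := Hyperplane {
  hset :> fell 'rV[R]_d.+1;
  hset_plane : exists u r, u != 0 /\ cset hset = plane u r }.

Section hyperplane_space.
Variables (R : realType) (d : nat).

Lemma continuous_dotv (u : 'rV[R]_d.+1) : continuous (dotv u).
Proof.
have addc : continuous (fun x : R * R => x.1 + x.2) by exact: add_continuous.
apply: (@continuous_big R 'I_d.+1 +%R 0 xpredT addc 'rV[R]_d.+1
  (index_enum _) (fun i x => u ord0 i * x ord0 i)) => i _ x.
apply: (continuousM (s := fun=> u ord0 i)); first exact: cst_continuous.
exact: coord_continuous.
Qed.

Lemma closed_plane (u : 'rV[R]_d.+1) (r : R) : closed (plane u r).
Proof.
by apply: (@preimage_closed _ _ (dotv u) [set r]) => [x _|];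
  [exact: continuous_dotv|exact: closed_eq].
Qed.

Definition hyperplane0 : hyperplane R d.
Proof.
have one0 : const_mx 1 != 0 :> 'rV[R]_d.+1.
  by apply/eqP => /rowP/(_ ord0); rewrite !mxE; apply/eqP/oner_neq0.
exact: (@Hyperplane R d (ClosedSubset (@closed_plane (const_mx 1) 0))
  (ex_intro _ _ (ex_intro _ _ (conj one0 erefl)))).
Defined.

HB.instance Definition _ := gen_eqMixin (hyperplane R d).
HB.instance Definition _ := gen_choiceMixin (hyperplane R d).
HB.instance Definition _ := isPointed.Build (hyperplane R d) hyperplane0.

End hyperplane_space.

(* The space of hyperplanes, with the sigma-algebra inherited from [fell]. *)
Definition hyp (R : realType) (d : nat) : Type :=
  g_sigma_algebra_preimageType (@hset R d).

HB.instance Definition _ (R : realType) (d : nat) :=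
  Measurable.copy (hyp R d) (g_sigma_algebra_preimageType (@hset R d)).

Section tessellations.
Variables (R : realType) (d : nat).
Notation V := 'rV[R]_d.+1.
Notation Hyp := (hyp R d).

Definition points (H : Hyp) : set V := cset (hset H).

Definition hit (B : set V) : set Hyp := [set H | points H `&` B !=set0].

(* A measure is a total function on sets, with unspecified values outside the
   sigma-algebra; hence the guard [measurable (hit B)]. *)
Definition locally_finite_hyp (Lambda : set Hyp -> \bar R) :=
  forall B : set V, bounded_set B -> measurable (hit B) ->
    (Lambda (hit B) < +oo)%E.

Definition non_atomic (Lambda : set Hyp -> \bar R) :=
  forall A : set Hyp, measurable A -> (0 < Lambda A)%E ->
    exists B : set Hyp,
      [/\ measurable B, B `<=` A, (0 < Lambda B)%E & (Lambda B < Lambda A)%E].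

(* The polyhedral cells in W: the nonempty intersections of W with finitely many
   closed half-spaces. *)
Definition cell_space (W : set V) : set (fell V) :=
  [set F | cset F !=set0 /\
    exists (m : nat) (u : 'I_m -> V) (r : 'I_m -> R),
      cset F = W `&` [set x | forall i, dotv (u i) x <= r i]].

(* The two open sides of a hyperplane.  They are told apart by the normal vector
   whose first nonzero coordinate is positive, so that the choice of the side is
   a measurable function of the hyperplane. *)
Definition lexpos (u : V) :=
  exists2 i, 0 < u ord0 i & forall j : 'I_d.+1, (j < i)%N -> u ord0 j = 0.

Definition side (b : bool) (H : Hyp) : set V :=
  [set x | exists u r, [/\ lexpos u, points H = plane u r &
    if b then r < dotv u x else dotv u x < r]].

(* The sub-cells c^+ and c^- of c cut out by H.  If c lies on one side of H, which
   merely touches it, then one of them is c and the other one is empty; empty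
   sets are not counted as cells of the tessellation (see [mnw_cells]). *)
Definition subcell (b : bool) (c : set V) (H : Hyp) : set V :=
  closure (c `&` side b H).

Section mnw.
Variables (Lambda : set Hyp -> \bar R) (W : set V).
Variables (dO : measure_display) (Omega : measurableType dO).
Variable (P : probability Omega R).
(* The cells that are ever created are indexed by the words over {+,-}: the root
   [::] is W, and b :: w is the sub-cell of w on side b.  To w are attached the
   lifetime L w (+oo if the cell is hit by Lambda-almost no hyperplane) and the
   hyperplane H w that splits the cell when it dies. *)
Variables (L : seq bool -> Omega -> \bar R) (H : seq bool -> Omega -> Hyp).

Fixpoint mnw_cell (w : seq bool) (o : Omega) : set V :=
  if w is b :: w' then subcell b (mnw_cell w' o) (H w' o) else W.

Fixpoint birth_time (w : seq bool) (o : Omega) : \bar R :=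
  if w is _ :: w' then (birth_time w' o + L w' o)%E else 0%E.

Definition lifetime_law (c : set V) (B : set (\bar R)) : \bar R :=
  if Lambda (hit c) == 0%E then \d_(+oo%E : \bar R) B
  else exponential_prob (fine (Lambda (hit c))) (EFin @^-1` B).

(* A cell with infinite lifetime is never split: there is then no condition on
   the law of its hyperplane. *)
Definition split_law (c : set V) (C : set Hyp) : \bar R :=
  if Lambda (hit c) == 0%E then 1%E
  else (fine (Lambda (C `&` hit c)) / fine (Lambda (hit c)))%:E.

(* The sigma-algebra generated by the lifetimes and the splitting hyperplanes of
   the first n generations of cells. *)
Definition mnw_past (n : nat) : set (set Omega) :=
  <<s \bigcup_(v in [set v : seq bool | (size v < n)%N])
        (preimage_set_system setT (L v) measurable `|`
         preimage_set_system setT (H v) measurable) >>.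

(* Conditionally on the first n generations, hence on the cells of generation n,
   the pairs (lifetime, splitting hyperplane) of the latter are independent, and
   in each pair the lifetime and the hyperplane are independent with the laws
   prescribed by the cell. *)
Definition is_mnw : Prop :=
  [/\ forall w, measurable_fun setT (L w),
      forall w, measurable_fun setT (H w) &
      forall (n : nat) (A : set Omega)
        (B : n.-tuple bool -> set (\bar R)) (C : n.-tuple bool -> set Hyp),
      mnw_past n A ->
      (forall w, measurable (B w)) -> (forall w, measurable (C w)) ->
      P (A `&` [set o | forall w : n.-tuple bool,
                  B w (L w o) /\ ((L w o < +oo)%E -> C w (H w o))]) =
      (\int[P]_(o in A) \prod_(w : n.-tuple bool)
         (lifetime_law (mnw_cell w o) (B w)
          * split_law (mnw_cell w o) (C w)))%E].

(* The cells of Y(t, W). *)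
Definition mnw_cells (t : R) (o : Omega) : set (fell V) :=
  [set c | cset c !=set0 /\
    exists w, [/\ cset c = mnw_cell w o, (birth_time w o <= t%:E)%E &
                  (t%:E < birth_time w o + L w o)%E]].

End mnw.

Section pht.
Variables (W : set V) (dO : measure_display) (Omega : measurableType dO).
Variable (P : probability Omega R).
(* A simple point process, given as a random set of hyperplanes. *)
Variable (eta : Omega -> set Hyp).

Definition npoints (B : set Hyp) (o : Omega) : \bar R := counting (eta o `&` B).

(* The second argument of [poisson_prob] is a dummy. *)
Definition poisson_law (m : \bar R) (B : set Hyp) : Prop :=
  if m == +oo%E then P [set o | npoints B o = +oo%E] = 1%E
  else forall k : nat, P [set o | npoints B o = k%:R%:E] =
         poisson_prob (fine m) k [set k].

(* eta is a Poisson process with intensity measure M. *)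
Definition is_poisson_process (M : set Hyp -> \bar R) : Prop :=
  [/\ forall B, measurable B -> measurable_fun setT (npoints B),
      forall B, measurable B -> poisson_law (M B) B &
      forall (n : nat) (B : 'I_n -> set Hyp) (S : 'I_n -> set (\bar R)),
      (forall i, measurable (B i)) -> trivIset setT B ->
      (forall i, measurable (S i)) ->
      P [set o | forall i, S i (npoints (B i) o)] =
      (\prod_(i < n) P (npoints (B i) @^-1` S i))%E].

(* The cells are the closures of the connected components of what remains of W
   after removal of the hyperplanes. *)
Definition pht_cells (o : Omega) : set (fell V) :=
  let U := W `\` \bigcup_(H in eta o) points H in
  [set c | exists2 x, U x & cset c = closure (connected_component U x)].

End pht.

(* E sum_{c in cells} delta_c *)
Definition mean_cell_measure (dO : measure_display) (Omega : measurableType dO)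
    (P : probability Omega R) (cells : Omega -> set (fell V))
    (B : set (fell V)) : \bar R :=
  (\int[P]_o \esum_(c in cells o) \d_c B)%E.

End tessellations.

(* Main.v *)
Require Import Defs.
From HB Require Import structures.
From mathcomp Require Import all_boot all_order all_algebra.
From mathcomp Require Import all_classical all_reals all_analysis.
From mathcomp Require Import measurable_realfun.
From mathcomp Require Import ring lra.

Set Implicit Arguments.
Unset Strict Implicit.
Unset Printing Implicit Defensive.

Import Order.TTheory GRing.Theory Num.Theory.
Import numFieldNormedType.Exports.
Local Open Scope classical_set_scope.
Local Open Scope ring_scope.

(* Fix a sequence [x] of points dense in W. A cell of either tessellation is the
   closure of an open cell, hence is determined by the set of indices [j] such that
   [x j] lies in this open cell. Counting a cell at the least of these indices,
   both mean measures are sums over [i] of the probability that the random set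
   S_i of the indices [j] with [x j] in the open cell of [x i] lies in a measurable
   set, and only the laws of the S_i matter. Such a law is determined by the
   probabilities of the events that S_i contains a given nonempty finite set [J],
   and in both models this probability is exp (- t Lambda [Z]), where the star [Z]
   is the union of the segments from [x i] to the [x j], [j] in [J].
   For the Poisson tessellation it is a void probability. For the MNW construction
   let p_n be the probability that the open cell of some cell of generation [n] alive
   at time [t] contains [Z], and let h_n be the sum over the words [w] of
   length [n] of the expectations of exp (- (t - birth_w) Lambda [Z]) over the event
   that the open cell of [w] contains [Z] and birth_w <= t. Conditioning
   on the step made by each cell gives h_n = p_n + h_{n+1}; moreover
   h_0 = exp (- t Lambda [Z]), and h_n tends to 0 geometrically. *)

(** A random collection of cells is awkward to measure, whereas the sets S_i are random variables:
    the event that S_i contains [J] only involves the sides of planes on which countably many fixed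
    points lie and, in the MNW model, lifetimes. As cells are convex, containing the points amounts
    to containing the star, and a plane that misses the connected star leaves it on one side; so the
    single number Lambda [Z] governs both models. For h_n = p_n + h_{n+1}, let the cell have rate r,
    put a = Lambda [Z], and let s be the time left. The cell stays undivided with probability exp (-
    s r), and planes missing the star divide it at rate r - a, whence exp (- s a) is exp (- s r)
    plus the integral over l in [0, s] of (r - a) exp (- r l) exp (- (s - l) a). The decay of h_n is
    read off from the weight exp (- birth), which dominates it up to the factor exp t: one division
    multiplies the mean weight by (r - a) / (r + 1), at most b / (b + 1) with b = Lambda [W]. This
    also replaces a separate argument that divisions do not accumulate before [t]. *)

(** * Hyperplanes, their two sides, and segments *)

Section hyperplane_sides.
Variables (R : realType) (d : nat).
Notation V := 'rV[R]_d.+1.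
Implicit Types (u v x y z : V) (r s : R) (H : hyp R d).

Lemma dotvDr u x y : dotv u (x + y) = dotv u x + dotv u y.
Proof.
by rewrite /dotv -big_split; apply: eq_bigr => i _; rewrite mxE mulrDr.
Qed.

Lemma dotvZr u s x : dotv u (s *: x) = s * dotv u x.
Proof.
by rewrite /dotv mulr_sumr; apply: eq_bigr => i _; rewrite mxE mulrCA.
Qed.

Lemma dotvNl u x : dotv (- u) x = - dotv u x.
Proof.
by rewrite /dotv -sumrN; apply: eq_bigr => i _; rewrite mxE mulNr.
Qed.

Lemma dotvNr u x : dotv u (- x) = - dotv u x.
Proof. by rewrite -scaleN1r dotvZr mulN1r. Qed.

Lemma dotvBr u x y : dotv u (x - y) = dotv u x - dotv u y.
Proof. by rewrite dotvDr dotvNr. Qed.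

Lemma dotv_delta u i : dotv u (delta_mx 0 i) = u ord0 i.
Proof.
rewrite /dotv (bigD1 i)//= mxE !eqxx mulr1 big1 ?addr0// => j ji.
by rewrite mxE (negbTE ji) andbF mulr0.
Qed.

Lemma plane_opp u r : plane (- u) (- r) = plane u r.
Proof.
by apply/seteqP; split => x; rewrite /plane/= dotvNl; [move/oppr_inj|move->].
Qed.

(* With the first nonzero coordinate of the normal in position i, the points
   above the plane are those that reach it by moving against the i-th axis and
   whose parallels to the earlier axes miss it: this only depends on the plane. *)
Lemma above_plane_lexpos u v r s x : lexpos u -> lexpos v ->
  plane u r = plane v s -> r < dotv u x -> s < dotv v x.
Proof.
move=> [i ui0 uj0] [k vk0 vj0] uv ux.
have pl y : dotv u y = r <-> dotv v y = s.
  by move: (congr1 (fun A => A y) uv); rewrite /plane/= => ->.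
have xu : dotv u x != r by rewrite gt_eqF.
pose a := (r - dotv u x) / u ord0 i.
have a0 : a < 0 by rewrite ltr_pdivrMr// mul0r subr_lt0.
have /pl : dotv u (x + a *: delta_mx 0 i) = r.
  by rewrite dotvDr dotvZr dotv_delta /a divfK ?gt_eqF// addrC subrK.
rewrite dotvDr dotvZr dotv_delta => va.
have [ik|ki|ik] := ltgtP i k.
- by move: va; rewrite (vj0 i)// mulr0 addr0 => /pl/eqP; rewrite (negbTE xu).
- pose b := (s - dotv v x) / v ord0 k.
  have /pl : dotv v (x + b *: delta_mx 0 k) = s.
    by rewrite dotvDr dotvZr dotv_delta /b divfK ?gt_eqF// addrC subrK.
  by rewrite dotvDr dotvZr dotv_delta (uj0 k)// mulr0 addr0 => /eqP; rewrite (negbTE xu).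
- move: va; rewrite ik.
  by move=> <-; rewrite gtrDl nmulr_rlt0.
Qed.

Lemma below_plane_lexpos u v r s x : lexpos u -> lexpos v ->
  plane u r = plane v s -> dotv u x < r -> dotv v x < s.
Proof.
move=> lu lv uv ux; have [//|vx|vx] := ltgtP (dotv v x) s.
- by have := above_plane_lexpos lv lu (esym uv) vx; rewrite ltNge (ltW ux).
- have : plane v s x by [].
  by rewrite -uv /plane/= => ux'; rewrite ux' ltxx in ux.
Qed.

Lemma lexpos_ex u : u != 0 -> lexpos u \/ lexpos (- u).
Proof.
move=> u0; have [k uk] : exists k, u ord0 k != 0.
  by apply/existsP; apply: contraNT u0 => /existsPn u0; apply/eqP/rowP => k;
    have := u0 k; rewrite negbK mxE => /eqP.
have [i ui umin] := @arg_minnP _ k (fun i => u ord0 i != 0) (fun i : 'I_d.+1 => i : nat) uk.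
have uj0 (j : 'I_d.+1) : (j < i)%N -> u ord0 j = 0.
  by move=> ji; apply/eqP; apply/negPn/negP => /umin; rewrite leqNgt ji.
have [ui0|ui0|/eqP] := ltgtP 0 (u ord0 i); last by rewrite eq_sym (negbTE ui).
- by left; exists i.
- right; exists i; first by rewrite mxE oppr_gt0.
  by move=> j /uj0; rewrite mxE => ->; rewrite oppr0.
Qed.

Lemma hyp_lexpos H : exists u r, lexpos u /\ points H = plane u r.
Proof.
rewrite /points; case: H => F/= [u [r [u0 ->]]].
by have [lu|lu] := lexpos_ex u0; [exists u, r|exists (- u), (- r); rewrite plane_opp].
Qed.

Definition halfspace (b : bool) u r : set V :=
  [set x | if b then r < dotv u x else dotv u x < r].

(** All lexicographically positive equations of a plane agree on which side is above, so one pair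
    [u], [r] serves both sides and the quantifiers in [side] disappear. *)
Lemma sideE H : exists u r,
  points H = plane u r /\ forall b, side b H = halfspace b u r.
Proof.
have [u [r [lu Hur]]] := hyp_lexpos H; exists u, r; split=> // b.
apply/seteqP; split => [x [v [s [lv Hvs]]]|x]; last by exists u, r.
have vu : plane v s = plane u r by rewrite -Hvs.
case: b; rewrite /halfspace/=; first exact: above_plane_lexpos vu.
exact: below_plane_lexpos vu.
Qed.

Lemma side_cover H x : ~ points H x -> side true H x \/ side false H x.
Proof.
have [u [r [-> sE]]] := sideE H; rewrite !sE /halfspace /plane/= => /eqP.
by rewrite neq_lt => /orP[]; [right|left].
Qed.

Lemma side_points b H x : side b H x -> ~ points H x.
Proof.
have [u [r [-> sE]]] := sideE H; rewrite sE /halfspace /plane/= => + ux.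
by rewrite ux ltxx; case: b.
Qed.

Lemma side_disj b H x : side b H x -> ~ side (~~ b) H x.
Proof.
have [u [r [_ sE]]] := sideE H; rewrite !sE /halfspace/=.
by case: b => /= ux vx; have := lt_trans ux vx; rewrite ltxx.
Qed.

Definition seg x y : set V := [set z | exists2 s, 0 <= s <= 1 & z = x + s *: (y - x)].

Lemma dotv_seg u x y s : dotv u (x + s *: (y - x)) = (1 - s) * dotv u x + s * dotv u y.
Proof. by rewrite dotvDr dotvZr dotvBr; ring. Qed.

Lemma seg_start x y : seg x y x.
Proof. by exists 0; rewrite ?lexx ?ler01// scale0r addr0. Qed.

Lemma seg_end x y : seg x y y.
Proof. by exists 1; rewrite ?ler01 ?lexx// scale1r addrC subrK. Qed.

Lemma halfspace_seg b u r x y : halfspace b u r x -> halfspace b u r y ->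
  seg x y `<=` halfspace b u r.
Proof.
move=> hx hy z [s /andP[s0 s1] ->]; move: hx hy; rewrite /halfspace/= dotv_seg.
by case: b => hx hy; have [xy|xy] := leP (dotv u x) (dotv u y); nra.
Qed.

Lemma side_seg b H x y : side b H x -> side b H y -> seg x y `<=` side b H.
Proof. by have [u [r [_ sE]]] := sideE H; rewrite sE; exact: halfspace_seg. Qed.

Lemma seg_same_side b H x y :
  side b H x -> seg x y `&` points H = set0 -> side b H y.
Proof.
have [u [r [-> sE]]] := sideE H; rewrite sE /halfspace/= => hx sH.
set a := dotv u x in hx; set c := dotv u y.
(* Intermediate values made explicit: if [r] lay between [a] and [c], the segment would cross the
   plane at the parameter [(r - a) / (c - a)]. *)
suff h : ~ ((r - a) * (r - c) <= 0).
  by case: b hx => hx; rewrite ltNge; apply/negP => hc; apply: h; rewrite -/a -/c; nra.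
move=> acr; have ar : a != c.
  apply/eqP => ac; move: acr; rewrite -ac -expr2 leNgt exprn_even_gt0//=.
  by rewrite subr_eq0 eq_sym; case: b hx => [/gt_eqF ->|/lt_eqF ->].
suff : set0 (x + ((r - a) / (c - a)) *: (y - x)) by [].
have ca0 : c - a != 0 by rewrite subr_eq0 eq_sym.
have ca2 : 0 < (c - a) ^+ 2 by rewrite exprn_even_gt0.
rewrite -sH; split; last first.
  by rewrite /plane/= dotv_seg -/a -/c; field.
(* The square makes the denominator positive whatever the sign of [c - a]. *)
have -> : (r - a) / (c - a) = (r - a) * (c - a) / (c - a) ^+ 2 by field.
eexists; last by []; apply/andP; split.
  by apply: divr_ge0; [have := sqr_ge0 (r - a); nra|exact: ltW].
by rewrite ler_pdivrMr// mul1r; have := sqr_ge0 (c - r); nra.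
Qed.

End hyperplane_sides.

(** * Relatively open polyhedral cells, their closures, and dense sequences *)

Section cell_geometry.
Variables (R : realType) (d : nat).
Notation V := 'rV[R]_d.+1.
Implicit Types (u v x y z : V) (r : R) (H : hyp R d) (W A G O : set V).

Lemma meets_closure (T : topologicalType) (A G : set T) : open G ->
  closure A `&` G !=set0 <-> A `&` G !=set0.
Proof.
move=> oG; split=> [[x [clA Gx]]|[x [Ax Gx]]]; last first.
  by exists x; split => //; exact: subset_closure.
by apply: clA; exact: open_nbhs_nbhs.
Qed.

(** Closures taken at every division can thus be postponed to the end: see [mnw_cellE]. *)
Lemma closureI_open (T : topologicalType) (A G : set T) : open G ->
  closure (closure A `&` G) = closure (A `&` G).
Proof.
move=> oG; apply/seteqP; split; last by apply: closureS; apply: setSI; exact: subset_closure.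
move=> x clx B; rewrite nbhsE => -[U [oO Ox] OB].
have [y [[clAy Gy] Oy]] := clx U (open_nbhs_nbhs (conj oO Ox)).
have /(meets_closure _ (openI oG oO))[z [Az [Gz Oz]]] : closure A `&` (G `&` U) !=set0 by exists y.
by exists z; split => //; exact: OB.
Qed.

Lemma open_halfspace b u r : open (halfspace b u r).
Proof.
rewrite /halfspace; case: b => /=.
- apply: (@open_comp _ _ (dotv u) [set y | r < y]); last exact: open_gt.
  by move=> x _; exact: continuous_dotv.
- apply: (@open_comp _ _ (dotv u) [set y | y < r]); last exact: open_lt.
  by move=> x _; exact: continuous_dotv.
Qed.

Lemma open_side b H : open (side b H).
Proof. by have [u [r [_ ->]]] := sideE H; exact: open_halfspace. Qed.

Definition segconvex W := forall x y, W x -> W y -> seg x y `<=` W.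

Lemma convex_set_segconvex W : convex_set W -> segconvex W.
Proof.
move=> cW x y Wx Wy _ [s /andP[s0 s1] ->].
pose p : {i01 R} := Itv01 s0 s1.
have := cW y x p; rewrite !inE => /(_ Wy Wx); congr W.
rewrite /conv/= scalerBr scalerBl scale1r.
by rewrite addrCA.
Qed.

(** Open only relative to [W]: boundary points of [W] may belong to it, and [W] may have empty
    interior. *)
Definition open_cell W (s : seq (V * R)) : set V :=
  W `&` [set x | forall p, p \in s -> dotv p.1 x < p.2].

Definition is_open_cell W O := exists s : seq (V * R), O = open_cell W s.

Lemma is_open_cellW W : is_open_cell W W.
Proof. by exists [::]; apply/seteqP; split => [x|x []]. Qed.

Lemma is_open_cell_side W O b H : is_open_cell W O ->
  is_open_cell W (O `&` side b H).
Proof.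
move=> [s ->]; have [u [r [_ sE]]] := sideE H.
exists ((if b then (- u, - r) else (u, r)) :: s); rewrite sE.
apply/seteqP; split => [x [[Wx sx] hx]|x [Wx hx]].
- split=> // p; rewrite inE => /orP[/eqP ->|/sx//].
  by move: hx; rewrite /halfspace; case: b => //=; rewrite dotvNl ltrN2.
- split; first by split => // p ps; apply: hx; rewrite inE ps orbT.
  have /= := hx _ (mem_head _ _).
  by rewrite /halfspace; case: b {hx} => //=; rewrite dotvNl ltrN2.
Qed.

Lemma is_open_cell_sub W O : is_open_cell W O -> O `<=` W.
Proof. by move=> [s ->] x []. Qed.

Lemma is_open_cell_open W O : is_open_cell W O -> exists2 G, open G & O = W `&` G.
Proof.
move=> [s ->]; exists [set x | forall p, p \in s -> dotv p.1 x < p.2] => //.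
elim: s => [|p s IHs].
  by rewrite (_ : [set _ | _] = setT) ?eqEsubset//; exact: openT.
rewrite (_ : [set _ | _] = halfspace false p.1 p.2 `&` [set x | forall p, p \in s -> dotv p.1 x < p.2]).
  by apply: openI => //; exact: open_halfspace.
apply/seteqP; split => [x h|x [hp h] q].
  by split; [exact/h/mem_head|move=> q qs; apply: h; rewrite inE qs orbT].
by rewrite inE => /orP[/eqP ->|/h].
Qed.

Lemma is_open_cell_seg W O : segconvex W -> is_open_cell W O -> segconvex O.
Proof.
move=> cW [s ->] x y [Wx sx] [Wy sy] z zxy; split; first exact: cW zxy.
by move=> p ps; apply: (@halfspace_seg _ _ false p.1 p.2 x y) zxy; [exact: sx|exact: sy].
Qed.

(** Moving from a solution of the weak inequalities towards a solution of the strict ones makes all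
    of them strict at once. Without a strict solution the weak system may still have some, hence the
    nonemptiness. *)
Lemma closure_open_cell W s : closed W -> segconvex W -> open_cell W s !=set0 ->
  closure (open_cell W s) = W `&` [set x | forall p, p \in s -> dotv p.1 x <= p.2].
Proof.
move=> clW cW [y [Wy sy]]; apply/seteqP; split.
  move=> x clx; split.
    by rewrite ((closure_id W).1 clW); apply: closureS clx => z [].
  move=> p ps; rewrite leNgt; apply/negP => px.
  have [z [[_ /(_ _ ps) zp] /ltW]] := clx _ (open_nbhs_nbhs (conj (@open_halfspace true p.1 p.2) px)).
  by rewrite leNgt zp.
move=> x [Wx sx] B /nbhs_ballP[e/= e0 eB].
(* A step short enough to stay within [e] of [x]; the summand 1 keeps the denominator nonzero when
   [y = x]. *)
pose a := Num.min 1 (e / (2 * (1 + `|y - x|))).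
have n0 : 0 < 1 + `|y - x| by rewrite ltr_wpDr.
have a0 : 0 < a by rewrite lt_min ltr01/= divr_gt0// mulr_gt0.
have a1 : a <= 1 by rewrite ge_min lexx.
exists (x + a *: (y - x)); split; first split.
- by apply: (cW x y) => //; exists a => //; rewrite a1 ltW.
- by move=> p ps; rewrite dotv_seg; have := sx _ ps; have := sy _ ps; nra.
- apply: eB; rewrite -ball_normE/= opprD addrA subrr sub0r normrN normrZ gtr0_norm//.
  have ae : a <= e / (2 * (1 + `|y - x|)) by rewrite ge_min lexx orbT.
  have /= := ler_wpM2r (ltW n0) ae.
  rewrite (_ : e / (2 * (1 + `|y - x|)) * (1 + `|y - x|) = e / 2); last by field; rewrite gt_eqF.
  by have := normr_ge0 (y - x); nra.
Qed.

Lemma cell_space_closure W O (F : fell V) : closed W -> segconvex W ->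
  is_open_cell W O -> O !=set0 -> cset F = closure O -> cell_space W F.
Proof.
move=> clW cW [s ->] O0 FO; split.
  by rewrite FO; have [x Ox] := O0; exists x; exact: subset_closure.
exists (size s), (fun i => (tnth (in_tuple s) i).1), (fun i => (tnth (in_tuple s) i).2).
rewrite FO closure_open_cell//; apply/seteqP; split => x [Wx sx]; split => //.
- by move=> i; apply: sx; rewrite mem_tnth.
- by move=> p /(@tnthP _ _ (in_tuple s))[i ->]; exact: sx.
Qed.

Definition rat_ball (k : 'rV[rat]_d.+1 * nat) : set V :=
  ball (map_mx ratr k.1 : V) k.2.+1%:R^-1.

Lemma open_rat_ball k : open (rat_ball k).
Proof. exact: ball_open. Qed.

Lemma rat_ball_basis G y : open G -> G y ->
  exists k, rat_ball k y /\ rat_ball k `<=` G.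
Proof.
move=> oG Gy.
have [e/= e0 eG] := iffLR (nbhs_ballP _ _) (open_nbhs_nbhs (conj oG Gy)).
have [k ke] : exists k, 2 * k.+1%:R^-1 < e :> R.
  have e2 : 0 < e / 2 by rewrite divr_gt0.
  have [k] := ltr_add_invr e2.
  by rewrite add0r => ke; exists k; rewrite mulrC -ltr_pdivlMr.
have k0 : 0 < k.+1%:R^-1 :> R by rewrite invr_gt0.
have [c yc] : exists c : 'rV[rat]_d.+1, ball (map_mx ratr c : V) k.+1%:R^-1 y.
  have h (i : 'I_d.+1) : exists a : rat, `|ratr a - y ord0 i| < k.+1%:R^-1.
    have [z [/= + [a _ az]]] := @dense_rat R (ball (y ord0 i) k.+1%:R^-1)
      (ex_intro _ _ (ballxx _ k0)) (ball_open _ _).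
    by rewrite -az /ball/= distrC => ?; exists a.
  have [f hf] := choice h.
  exists (\row_i f i); split => // i j; rewrite (ord1 i) !mxE.
  exact: hf.
exists (c, k); split => // z cz; apply: eG; apply: le_ball (ltW ke) _ _.
by rewrite mulr_natl mulr2n; apply: ball_triangle cz; exact: ball_sym.
Qed.

Lemma dense_seq_ex W : W !=set0 -> exists x : nat -> V,
  (forall i, W (x i)) /\ forall G, open G -> W `&` G !=set0 -> exists i, G (x i).
Proof.
move=> [x0 Wx0].
(* One point of [W] is chosen in each rational ball that meets [W]; [x0] fills the remaining
   places. *)
pose pt k := if pselect (W `&` rat_ball k !=set0) is left e then projT1 (cid e) else x0.
exists (fun n => if unpickle n is Some k then pt k else x0); split.
  by move=> i; case: unpickle => // k; rewrite /pt; case: pselect => // e; case: cid => ? [].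
move=> G oG [y [Wy Gy]]; have [k [ky kG]] := rat_ball_basis oG Gy.
exists (pickle k); rewrite pickleK /pt.
case: pselect => [e|[]]; last by exists y.
by case: cid => z [/= Wz kz]; exact: kG.
Qed.

End cell_geometry.

(** * Measurability for the Fell topology *)

Section fell_measurability.
Variables (R : realType) (d : nat).
Notation V := 'rV[R]_d.+1.
Implicit Types (F : fell V) (G K : set V).

Lemma fell_open_hits (T : topologicalType) (G : set T) : open G ->
  open ([set F | cset F `&` G !=set0] : set (closed_subset T)).
Proof.
move=> oG; exists [set [set F : closed_subset T | cset F `&` G !=set0]].
  by move=> _ ->; exact: (@finI_from1 _ _ _ _ (false, G)).
by rewrite bigcup_set1.
Qed.

Lemma fell_open_misses (T : topologicalType) (K : set T) : compact K ->
  open ([set F | cset F `&` K = set0] : set (closed_subset T)).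
Proof.
move=> cK; exists [set [set F : closed_subset T | cset F `&` K = set0]].
  by move=> _ ->; exact: (@finI_from1 _ _ _ _ (true, K)).
by rewrite bigcup_set1.
Qed.

Lemma measurable_hits_open G : open G ->
  measurable [set F : fell V | cset F `&` G !=set0].
Proof. by move=> oG; apply: sub_sigma_algebra; exact: fell_open_hits. Qed.

Lemma measurable_hits_compact K : compact K ->
  measurable [set F : fell V | cset F `&` K !=set0].
Proof.
move=> cK; rewrite -[X in measurable X]setCK; apply: measurableC.
rewrite (_ : ~` _ = [set F : fell V | cset F `&` K = set0]).
  by apply: sub_sigma_algebra; exact: fell_open_misses.
by apply/seteqP; split => F /=; [move=> /set0P/negP; rewrite negbK => /eqP|move=> ->[]].
Qed.

(** Missing an open ball is not a Fell-open condition, so these sets need not be open. They form a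
    countable network: each open set is the union of those it contains. They only involve hits of
    open balls and complements of such hits. *)
Definition fell_base (l : seq (bool * ('rV[rat]_d.+1 * nat))) :
    set (closed_subset V) :=
  [set F | forall p, p \in l ->
     if p.1 then cset F `&` rat_ball p.2 !=set0
     else cset F `&` rat_ball p.2 = set0].

Lemma fell_base_cat l l' : fell_base (l ++ l') = fell_base l `&` fell_base l'.
Proof.
apply/seteqP; split => [F h|F [h h'] p].
  by split => p pl; apply: h; rewrite mem_cat pl ?orbT.
by rewrite mem_cat => /orP[/h|/h'].
Qed.

Lemma fell_base_hits G (F : closed_subset V) : open G -> cset F `&` G !=set0 ->
  exists l, fell_base l F /\ fell_base l `<=` [set F | cset F `&` G !=set0].
Proof.
move=> oG [y [Fy Gy]]; have [k [ky kG]] := rat_ball_basis oG Gy.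
exists [:: (true, k)]; split => [p|F' /(_ _ (mem_head _ _))[z [Fz kz]]].
  by rewrite inE => /eqP ->; exists y.
by exists z; split => //; exact: kG.
Qed.

(** The complement of [F] is open, so rational balls missing [F] cover [K]; a finite subcover gives
    the list. *)
Lemma fell_base_misses K (F : closed_subset V) : compact K -> cset F `&` K = set0 ->
  exists l, fell_base l F /\ fell_base l `<=` [set F | cset F `&` K = set0].
Proof.
rewrite compact_cover => cK FK0.
have := cK _ [set k | cset F `&` rat_ball k = set0] (@rat_ball R d).
case=> [k _|y Ky|D DF KD]; first exact: open_rat_ball.
  have Fy : (~` cset F) y by move=> Fy; have : set0 y by rewrite -FK0.
  have oF : open (~` cset F) by rewrite openC; exact: cset_closed.
  have [k [ky kF]] := rat_ball_basis oF Fy; exists k => //=.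
  by rewrite -subset0 => z [Fz /kF].
exists [seq (false, k) | k <- finmap.enum_fset D]; split.
  by move=> _ /mapP[k kD ->]/=; have := DF k kD; rewrite inE.
move=> F' h; rewrite /= -subset0 => z [F'z /KD[k kD kz]].
have := h (false, k); rewrite map_f// => /(_ isT)/= e.
have : (cset F' `&` rat_ball k) z by [].
by rewrite e.
Qed.

Lemma fell_base_basis (U : set (closed_subset V)) F : open U -> U F ->
  exists l, fell_base l F /\ fell_base l `<=` U.
Proof.
move=> [D' D'f <-] [A D'A AF]; have [J JD AE] := D'f _ D'A.
suff [l [lF lA]] : exists l, fell_base l F /\ fell_base l `<=` A.
  by exists l; split => // F' /lA AF'; exists A.
have : {subset finmap.enum_fset J <= [set i : bool * set V | if i.1 then compact i.2 else open i.2]}.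
  by move=> i; exact: JD.
have : forall i, i \in finmap.enum_fset J ->
    if i.1 then cset F `&` i.2 = set0 else cset F `&` i.2 !=set0.
  by move=> i iJ; move: AF; rewrite -AE => /(_ i iJ)/=; case: i.1.
rewrite -{}AE {JD A D'A AF}.
rewrite (_ : \bigcap_(i in _) _ = [set F' : closed_subset V | forall i,
    i \in finmap.enum_fset J ->
    if i.1 then cset F' `&` i.2 = set0 else cset F' `&` i.2 !=set0]); last first.
  by apply/seteqP; split => F' /= h i /h; case: i.1.
elim: (finmap.enum_fset J) => [_ _|i s IHs Fs sD].
  by exists [::]; split.
have [|j js|l [lF ls]] := IHs.
- by move=> j js; apply: Fs; rewrite inE js orbT.
- by apply: sD; rewrite inE js orbT.
have [l' [l'F l's]] : exists l', fell_base l' F /\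
    fell_base l' `<=` [set F' | if i.1 then cset F' `&` i.2 = set0
                                else cset F' `&` i.2 !=set0].
  have := Fs i (mem_head _ _); have := sD i (mem_head _ _); rewrite inE/=.
  by case: i.1 => ? ?; [exact: fell_base_misses|exact: fell_base_hits].
exists (l' ++ l); rewrite fell_base_cat; split => // F' [/l's h /ls h'] j.
by rewrite inE => /orP[/eqP ->|/h'].
Qed.

Lemma measurable_fell_base dT (T : measurableType dT) (f : T -> fell V) l :
  (forall G, open G -> measurable [set t | cset (f t) `&` G !=set0]) ->
  measurable [set t | fell_base l (f t)].
Proof.
move=> mf; elim: l => [|[b k] l IHl].
  by rewrite (_ : [set _ | _] = setT); [exact: measurableT|apply/seteqP; split].
have mk := mf _ (@open_rat_ball R d k).
pose S := [set t | cset (f t) `&` rat_ball k !=set0].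
rewrite (_ : [set _ | _] = (if b then S else ~` S) `&` [set t | fell_base l (f t)]).
  by apply: measurableI => //; case: b => //; exact: measurableC.
apply/seteqP; split => t; rewrite /= -cat1s fell_base_cat => -[h lt]; split => //.
  have := h _ (mem_head _ _); case: b {h} => //= tk.
  by rewrite /S/= tk => -[].
move=> p; rewrite inE => /eqP ->/=; case: b h => //= h.
by apply/eqP/negPn/negP => /set0P.
Qed.

(** Hits of open sets suffice: the preimage of a Fell-open set is a countable union of preimages of
    network sets, and a miss is the complement of a hit. *)
Lemma measurable_fun_fell dT (T : measurableType dT) (f : T -> fell V) :
  (forall G, open G -> measurable [set t | cset (f t) `&` G !=set0]) ->
  measurable_fun setT f.
Proof.
move=> mf; apply: (@measurability _ _ T (fell V) setT f (@open (closed_subset V))) => //.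
move=> _ [U oU <-]; rewrite setTI.
rewrite (_ : f @^-1` U = \bigcup_l
    (if pselect (fell_base l `<=` U) then [set t | fell_base l (f t)] else set0)).
  apply: (countable_bigcupT_measurable (countableP _)) => l.
  by case: pselect => [?|?]; [exact: measurable_fell_base|exact: measurable0].
apply/seteqP; split => [t Ut|t [l _]].
  have [l [lt lU]] := fell_base_basis oU Ut.
  by exists l => //; case: pselect.
by case: pselect => // lU; exact: lU.
Qed.

Lemma measurable_hset : measurable_fun setT (@hset R d : hyp R d -> fell V).
Proof. by move=> _ B mB; exists B. Qed.

Lemma measurable_hit_open G : open G -> measurable (@hit R d G).
Proof.
move=> oG; rewrite -[X in measurable X]setTI.
exact: measurable_hset (measurable_hits_open oG).
Qed.

Lemma measurable_hit_compact K : compact K -> measurable (@hit R d K).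
Proof.
move=> cK; rewrite -[X in measurable X]setTI.
exact: measurable_hset (measurable_hits_compact cK).
Qed.

End fell_measurability.

(** * Measurability of sides and of hitting a cell *)

Section hit_measurability.
Variables (R : realType) (d : nat).
Notation V := 'rV[R]_d.+1.
Implicit Types (x y v : V) (H : hyp R d) (W A : set V).

Lemma segE x y : seg x y = (fun s : R => x + s *: (y - x)) @` `[0, 1].
Proof.
apply/seteqP; split => [z [s s01 ->]|_ [s /= s01 <-]].
  by exists s => //=; rewrite in_itv.
by exists s => //; rewrite in_itv/= in s01.
Qed.

Lemma continuous_seg x y : {within `[0, 1], continuous (fun s : R => x + s *: (y - x))}.
Proof.
apply: continuous_subspaceT => s; apply: cvgD; first exact: cvg_cst.
by apply: cvgZr_tmp; exact: cvg_id.
Qed.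

Lemma compact_seg x y : compact (seg x y).
Proof.
rewrite segE; apply: continuous_compact; last exact: segment_compact.
exact: continuous_seg.
Qed.

Lemma connected_seg x y : connected (seg x y).
Proof.
rewrite segE; apply: connected_continuous_connected; first exact: segment_connected.
exact: continuous_seg.
Qed.

(** A ray is not compact, but it is exhausted by countably many compact segments. *)
Lemma measurable_hit_ray x v :
  measurable [set H : hyp R d | exists2 s, 0 <= s & points H (x + s *: v)].
Proof.
rewrite (_ : [set _ | _] = \bigcup_n hit (seg x (x + n.+1%:R *: v))).
  by apply: bigcupT_measurable => n; exact/measurable_hit_compact/compact_seg.
apply/seteqP; split => [H [s s0 Hs]|H [n _ [z [Hz [s /andP[s0 s1] zE]]]]].
  exists (Num.truncn s) => //; exists (x + s *: v); split => //.
  have sn : s < (Num.truncn s).+1%:R by rewrite truncnS_gt.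
  exists (s / (Num.truncn s).+1%:R).
    by rewrite divr_ge0//= ler_pdivrMr// mul1r ltW.
  by rewrite addrAC subrr add0r scalerA divfK.
exists (s * n.+1%:R); first by rewrite mulr_ge0.
by move: Hz; rewrite zE addrAC subrr add0r scalerA.
Qed.

Lemma measurable_side b x : measurable [set H : hyp R d | side b H x].
Proof.
(* The lower side is what remains after the upper side and the planes through [x]. *)
wlog -> : b / b = true.
  move=> h; case: b; first exact: h.
  rewrite (_ : [set _ | _] = ~` ([set H | side true H x] `|` hit [set x])).
    apply: measurableC; apply: measurableU; first exact: h.
    exact/measurable_hit_compact/compact_set1.
  apply/seteqP; split => [H /= Hx [Hx'|[y [Hy xy]]]|H /= Hx].
  - exact: (@side_disj _ _ false H x Hx Hx').
  - by move: Hy; rewrite xy; exact: side_points Hx.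
  - have xH : ~ points H x by move=> Hx'; apply: Hx; right; exists x.
    by have [Hx'|//] := side_cover xH; exfalso; apply: Hx; left.
pose e (i : 'I_d.+1) : V := delta_mx 0 i.
pose ray v := [set H : hyp R d | exists2 s, 0 <= s & points H (x + s *: v)].
have mray v : measurable (ray v) by exact: measurable_hit_ray.
pose line i := ray (e i) `|` ray (- e i).
have lineP i H s : points H (x + s *: e i) -> line i H.
  move=> Hs; have [s0|s0] := leP 0 s; first by left; exists s.
  by right; exists (- s); rewrite ?oppr_ge0 ?ltW// scalerN scaleNr opprK.
(* Here [i] is the first nonzero coordinate of the normal: the plane misses the parallels through
   [x] to the earlier axes and is reached from [x] by going down the [i]-th one. Only hits of rays
   occur. *)
rewrite (_ : [set _ | _] = \bigcup_i (~` hit [set x] `&` ray (- e i) `&`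
    \bigcap_(j in [set j : 'I_d.+1 | (j < i)%N]) ~` line j)).
  apply: fin_bigcup_measurable => // i _; apply: measurableI.
    apply: measurableI => //; apply: measurableC.
    exact/measurable_hit_compact/compact_set1.
  apply: fin_bigcap_measurable => // j _; apply: measurableC.
  exact: measurableU.
apply/seteqP; split => H.
  move=> /= Hx; have [u [r [[i ui0 uj0] Hur ux]]] := Hx.
  exists i => //; split; first split.
  - by move=> [y [Hy xy]]; move: Hy; rewrite xy; exact: side_points Hx.
  - exists ((dotv u x - r) / u ord0 i).
      by rewrite divr_ge0// ltW// subr_gt0.
    rewrite Hur /plane/= dotvDr dotvZr dotvNr dotv_delta.
    by field; rewrite gt_eqF.
  - move=> j ji [] [s _]; rewrite Hur /plane/= dotvDr dotvZr ?dotvNr dotv_delta.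
      by rewrite uj0// mulr0 addr0 => e1; rewrite e1 ltxx in ux.
    by rewrite uj0// oppr0 mulr0 addr0 => e1; rewrite e1 ltxx in ux.
move=> [i _ [[xH [s s0 Hs]] Hj]].
have [u [r [lu Hur]]] := hyp_lexpos H.
exists u, r; split => //; case: lu => k uk0 uj0.
have xr : dotv u x != r.
  by apply/eqP => xr; apply: xH; exists x; split => //; rewrite Hur.
have [ki|ki] := ltnP k i.
  exfalso; apply: (Hj k ki); apply: (lineP _ _ ((r - dotv u x) / u ord0 k)).
  rewrite Hur /plane/= dotvDr dotvZr dotv_delta.
  by field; rewrite gt_eqF.
move: Hs; rewrite Hur /plane/= dotvDr dotvZr dotvNr dotv_delta mulrN => rE.
move: ki; rewrite leq_eqVlt => /orP[/eqP/val_inj ik|/uj0 ui0]; last first.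
  by move: xr; rewrite -rE ui0 mulr0 subr0 eqxx.
have : dotv u x - s * u ord0 i <= dotv u x by rewrite gerBl mulr_ge0// ik ltW.
by rewrite rE le_eqVlt eq_sym (negbTE xr).
Qed.

(** Reduces hitting a closed cell to countably many events of the form that [x i] lies in the open
    cell. For the converse, a plane missing the compact closure stays at a positive distance from
    it. *)
Lemma hit_closure W A H (x : nat -> V) : compact W -> A `<=` W ->
  (forall G, open G -> A `&` G !=set0 -> exists i, A (x i) /\ G (x i)) ->
  hit (closure A) H <->
  forall k : nat, exists i, A (x i) /\ hit (ball (x i) k.+1%:R^-1) H.
Proof.
move=> cW AW xd; split=> [[z [Hz Az]] k|h].
  have k0 : 0 < k.+1%:R^-1 :> R by rewrite invr_gt0.
  have [y [Ay zy]] := Az _ (nbhsx_ballx z _ k0).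
  have [i [Ai zi]] := xd _ (ball_open z k.+1%:R^-1) (ex_intro _ y (conj Ay zy)).
  by exists i; split => //; exists z; split => //; exact: ball_sym.
have cA : compact (closure A).
  apply: (@subclosed_compact _ _ W) => //; first exact: closed_closure.
  have clW : closed W by apply: compact_closed => //; exact: norm_hausdorff.
  by rewrite [X in _ `<=` X]((closure_id W).1 clW); exact: closureS.
apply: contrapT => nH.
have oH : open (~` points H) by rewrite openC; exact: cset_closed.
(* Compactness makes the radius of the balls missing the plane uniform over the closure. *)
have [k hk] : exists k : nat,
    closure A `<=` [set y | ball y k.+1%:R^-1 `&` points H = set0].
  have /compact_near_coveringP/(_ nat \oo) := cA.
  move=> /(_ (fun k y => ball y k.+1%:R^-1 `&` points H = set0) _) nA.
  apply: (@filter_ex _ \oo); apply: nA => y Ay.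
  have yH : (~` points H) y by move=> yH; apply: nH; exists y.
  have [e/= e0 eH] := iffLR (nbhs_ballP _ _) (open_nbhs_nbhs (conj oH yH)).
  have e2 : 0 < e / 2 by rewrite divr_gt0.
  exists (ball y (e / 2), [set k | k.+1%:R^-1 < e / 2 :> R]) => /=.
    split; first exact: nbhsx_ballx.
    exact: (near_infty_natSinv_lt (PosNum e2)).
  move=> [y' k] /= [yy' ke]; rewrite -subset0 => w [y'w Hw].
  apply: (eH w) => //; rewrite [e]splitr; apply: ball_triangle yy' _.
  exact: le_ball (ltW ke) _ y'w.
have [i [Ai [w [Hw iw]]]] := h k.
have : (ball (x i) k.+1%:R^-1 `&` points H) w by [].
by rewrite (hk _ (subset_closure Ai)).
Qed.

End hit_measurability.

(** * Null sets and integrals of possibly non-measurable functions *)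

Section negligible_lower_integral.
Context d (T : measurableType d) (R : realType) (mu : {measure set T -> \bar R}).
Import HBNNSimple.
Local Open Scope ereal_scope.

(* Unlike [ge0_negligible_integral], this does not ask [f] to be measurable. *)
Lemma lower_integral_negligible (f : T -> \bar R) (N : set T) :
  (forall x, 0 <= f x) -> measurable N -> mu N = 0 ->
  \int[mu]_x f x = \int[mu]_(x in ~` N) f x.
Proof.
move=> f0 mN N0; have mCN : measurable (~` N) by exact: measurableC.
rewrite ge0_integralTE// ge0_integralE//; apply/eqP; rewrite eq_le; apply/andP; split.
- apply: ge_ereal_sup => _ [h hf <-]; apply: ereal_sup_ubound.
  exists (proj_nnsfun h mCN) => [x|].
    rewrite /= patchE mindicE /=; case: ifPn => xN; rewrite ?mulr1 ?mulr0 ?lexx//.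
  transitivity (\int[mu]_(x in ~` N) (h x)%:E).
    by rewrite integral_nnsfun// mrestrict.
  rewrite -setTD -ge0_negligible_integral//; last 2 first.
    exact/measurable_EFinP.
    by move=> x _; rewrite lee_fin.
  by rewrite integralT_nnsfun.
- apply: ereal_sup_le => _ [h hf <-]; exists h => // x.
  apply: (le_trans (hf x)); rewrite patchE; case: ifPn => // _; exact: f0.
Qed.

Lemma eq_integral_negligible (f g : T -> \bar R) (N : set T) :
  (forall x, 0 <= f x) -> (forall x, 0 <= g x) ->
  measurable N -> mu N = 0 -> (forall x, ~ N x -> f x = g x) ->
  \int[mu]_x f x = \int[mu]_x g x.
Proof.
move=> f0 g0 mN N0 fg; rewrite (lower_integral_negligible f0 mN)//.
rewrite (lower_integral_negligible g0 mN)//.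
by apply: eq_integral => x; rewrite inE => /fg.
Qed.

End negligible_lower_integral.

(** * Random sets of indices and their laws *)

Section random_index_set.

Definition cylinder (J : seq nat) : set (set nat) := [set s | forall j, j \in J -> s j].

Definition idxset : Type := g_sigma_algebraType (range cylinder).

HB.instance Definition _ := Measurable.copy idxset (g_sigma_algebraType (range cylinder)).

Lemma cylinder_cat J J' : cylinder (J ++ J') = cylinder J `&` cylinder J'.
Proof.
apply/seteqP; split => [s h|s [h h'] j].
  by split => j jJ; apply: h; rewrite mem_cat jJ ?orbT.
by rewrite mem_cat => /orP[/h|/h'].
Qed.

Lemma measurable_idxset_mem j : measurable [set s : idxset | s j].
Proof.
apply: sub_sigma_algebra; exists [:: j] => //.
by apply/seteqP; split => [s|s sj i]; [apply; exact: mem_head|rewrite inE => /eqP ->].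
Qed.

Lemma measurable_fun_idxset d (T : measurableType d) (f : T -> idxset) :
  (forall J, measurable (f @^-1` cylinder J)) -> measurable_fun setT f.
Proof.
move=> mf; apply: (@measurability _ _ T idxset setT f (range cylinder)) => //.
by move=> _ [_ [J _ <-] <-]; rewrite setTI.
Qed.

(** Cylinders form a pi-system, since containing [J] and [J'] means containing [J ++ J'], and the
    cylinder of the empty list is the whole space; uniqueness of finite measures applies. *)
Lemma idxset_law (R : realType) d1 d2 (T1 : measurableType d1) (T2 : measurableType d2)
    (P1 : probability T1 R) (P2 : probability T2 R)
    (f1 : T1 -> idxset) (f2 : T2 -> idxset) :
  measurable_fun setT f1 -> measurable_fun setT f2 ->
  (forall J, P1 (f1 @^-1` cylinder J) = P2 (f2 @^-1` cylinder J)) ->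
  forall E : set idxset, measurable E -> P1 (f1 @^-1` E) = P2 (f2 @^-1` E).
Proof.
move=> mf1 mf2 f12 E mE.
pose g1 : {mfun T1 >-> idxset} := HB.pack f1 (isMeasurableFun.Build _ _ _ _ _ mf1).
pose g2 : {mfun T2 >-> idxset} := HB.pack f2 (isMeasurableFun.Build _ _ _ _ _ mf2).
apply: (@measure_unique _ _ idxset (range cylinder) (fun=> cylinder [::]) _ _ _ _
  (pushforward P1 g1) (pushforward P2 g2)) => //.
- move=> _ _ [J _ <-] [J' _ <-]; exists (J ++ J') => //.
  exact: cylinder_cat.
- by apply/seteqP; split => // s _; exists 0%N.
- by move=> _ [J _ <-]; exact: f12.
- move=> _; rewrite (_ : cylinder [::] = setT); last by apply/seteqP; split.
  by rewrite /= /pushforward preimage_setT probability_setT ltry.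
Qed.

End random_index_set.

(** * Counting cells at their least index *)

Section counting_cells.
Variables (R : realType) (d : nat).
Notation V := 'rV[R]_d.+1.
Variables (W : set V) (x : nat -> V).
Hypotheses (clW : closed W) (cW : segconvex W).
Hypothesis xW : forall i, W (x i).
Hypothesis xd : forall G, open G -> W `&` G !=set0 -> exists i, G (x i).

Lemma cset_inj (T : topologicalType) : injective (@cset T).
Proof. by move=> [A cA] [B cB] /= AB; subst B; congr ClosedSubset; exact: Prop_irrelevance. Qed.

Lemma open_cell_dense Q G : is_open_cell W Q -> open G -> Q `&` G !=set0 ->
  exists i, Q (x i) /\ G (x i).
Proof.
move=> cO oG [y [Oy Gy]]; have [U oU OE] := is_open_cell_open cO.
have [|i [Ui Gi]] := xd (openI oU oG).
  by exists y; move: Oy; rewrite OE => -[].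
by exists i; rewrite OE.
Qed.

Lemma closure_dense_open_cell Q : is_open_cell W Q ->
  closure (x @` [set j | Q (x j)]) = closure Q.
Proof.
move=> cO; apply/seteqP; split; first by apply: closureS => _ [j Oj <-].
move=> y Oy B; rewrite nbhsE => -[U [oU Uy] UB].
have [z Oz] := Oy _ (open_nbhs_nbhs (conj oU Uy)).
have [|i [Oi Ui]] := open_cell_dense cO oU; first by exists z.
by exists (x i); split; [exists i|exact: UB].
Qed.

(** Only a closure, without convex hull: by density it recovers a closed cell from the indices that
    fall in its open cell. *)
Definition closed_hull (s : idxset) : fell V :=
  ClosedSubset (@closed_closure _ (x @` s)).

Lemma measurable_closed_hull : measurable_fun setT closed_hull.
Proof.
apply: measurable_fun_fell => G oG.
rewrite (_ : [set _ | _] = \bigcup_j (if pselect (G (x j)) then [set s : idxset | s j] else set0)).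
  apply: bigcupT_measurable => j; case: pselect => [?|?]; last exact: measurable0.
  exact: measurable_idxset_mem.
apply/seteqP; split => s.
  move=> /(meets_closure _ oG)[_ [[j sj <-] Gj]]; exists j => //.
  by case: pselect.
move=> [j _]; case: pselect => // Gj sj; apply/(meets_closure _ oG).
by exists (x j); split => //; exists j.
Qed.

(** Empty when [x i] lies in no member of [C], for instance when it is on a dividing plane. *)
Definition index_set (C : set (set V)) (i : nat) : idxset :=
  [set j | exists2 Q, C Q & Q (x i) /\ Q (x j)].

Definition least_index (i : nat) : set idxset :=
  [set s | s i /\ forall j, (j < i)%N -> ~ s j].

Lemma measurable_least_index i : measurable (least_index i).
Proof.
rewrite (_ : least_index i = [set s : idxset | s i] `&`
    \bigcap_(j in `I_i) ~` [set s : idxset | s j]) //.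
apply: measurableI; first exact: measurable_idxset_mem.
apply: fin_bigcap_measurable => // j _; apply: measurableC.
exact: measurable_idxset_mem.
Qed.

Lemma least_index_inj s i j : least_index i s -> least_index j s -> i = j.
Proof.
move=> [si hi] [sj hj]; have [ij|ji|//] := ltngtP i j.
- by case: (hj i ij).
- by case: (hi j ji).
Qed.

Lemma least_index_ex (s : idxset) i : s i -> exists j, least_index j s.
Proof.
move=> si; have [j sj jmin] := @ex_minnP (fun i => `[< s i >]) (ex_intro _ i (asboolT si)).
exists j; split; first exact/asboolP.
by move=> k kj sk; have := jmin k (asboolT sk); rewrite leqNgt kj.
Qed.

Section family.
Variable C : set (set V).
Hypothesis C_cell : forall Q, C Q -> is_open_cell W Q.
Hypothesis C_disj : forall Q Q', C Q -> C Q' -> Q `&` Q' !=set0 -> Q = Q'.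

Lemma index_setE Q i : C Q -> Q (x i) -> index_set C i = [set j | Q (x j)].
Proof.
move=> CO Oi; apply/seteqP; split => j; last by exists Q.
by move=> [Q' CO' [Q'i Q'j]]; rewrite (C_disj CO CO')//; exists (x i).
Qed.

(** Every nonempty open cell contains some [x i], and exactly one index is the least of those in it;
    this puts the cells in bijection with [I]. *)
Lemma esum_cells (B : set (fell V)) :
  \esum_(c in [set c : fell V | cset c !=set0 /\ exists2 Q, C Q & cset c = closure Q])
     \d_c (B `&` cell_space W) =
  (\sum_(i <oo) (\1_(least_index i `&` closed_hull @^-1` B) (index_set C i))%:E)%E :> \bar R.
Proof.
pose I := [set i | least_index i (index_set C i)].
have IE i : I i -> exists2 Q, C Q & [/\ Q (x i), index_set C i = [set j | Q (x j)] &
    closure (x @` index_set C i) = closure Q].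
  move=> [[Q CO [Oi _]] _]; exists Q => //; split => //; first exact: index_setE.
  by rewrite (index_setE CO Oi) closure_dense_open_cell//; exact: C_cell.
rewrite (_ : [set c | _] = (fun i => closed_hull (index_set C i)) @` I); last first.
  apply/seteqP; split => [c [c0 [Q CO cO]]|_ [i /IE[Q CO [Oi iE hE]] <-]].
    have [|i [Oi _]] := @open_cell_dense Q setT (C_cell CO) openT.
      rewrite setIT; move: c0; rewrite cO => c0; apply/set0P; apply/eqP => O0.
      by move: c0; rewrite O0 closure0 => -[].
    have [|j jl] := @least_index_ex (index_set C i) i.
      by exists Q.
    have Oj : Q (x j) by case: jl; rewrite (index_setE CO Oi).
    exists j; first by rewrite /I/= (index_setE CO Oj) -(index_setE CO Oi).
    apply: cset_inj; rewrite cO /= (index_setE CO Oj).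
    by apply: closure_dense_open_cell; exact: C_cell.
  split; last by exists Q.
  by exists (x i); apply: subset_closure; exists i => //; rewrite iE.
rewrite esum_image; last first.
  move=> i j /set_mem Ii /set_mem Ij /(congr1 (@cset _)) /= hij.
  have [Q CO [Oi iE hi]] := IE _ Ii; have [Q' CO' [Q'j jE hj]] := IE _ Ij.
  (* Disjoint relatively open cells have distinct closures: if [x i] in [Q] belongs to the closure
     of [Q'], then [Q] meets [Q']. *)
  have OO' : Q = Q'.
    apply: C_disj => //; have [G oG OE] := is_open_cell_open (C_cell CO).
    have Gi : G (x i) by move: Oi; rewrite OE => -[].
    have : closure Q' (x i) by rewrite -hj -hij hi; exact: subset_closure.
    move=> /(_ _ (open_nbhs_nbhs (conj oG Gi)))[y [Q'y Gy]]; exists y; split => //.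
    by rewrite OE; split => //; exact: is_open_cell_sub (C_cell CO') _ Q'y.
  move: Ii Ij; rewrite /I/= iE jE OO'; exact: least_index_inj.
rewrite nneseries_esumT => [|i]; last by rewrite lee_fin.
rewrite esum_mkcond; apply: eq_esum => i _; rewrite diracE indicE.
have [/set_mem Ii|iI] := boolP (i \in I); last first.
  rewrite memNset// => -[iI' _]; by move: iI; rewrite notin_setE; apply.
congr ((nat_of_bool _)%:R%:E); apply/idP/idP; rewrite !inE => -[]//.
(* The trace on [cell_space W] costs nothing, as the closures of open cells are polyhedral cells. *)
move=> _ Bi; split => //; have [Q CO [Oi iE hE]] := IE _ Ii.
by apply: (@cell_space_closure _ _ W Q) => //; [exact: C_cell|exists (x i)].
Qed.

End family.

(** Common to both models. The family [C] has to behave well only off the null set [N], and no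
    measurability of [cells] is asked for: it is the substitutes [S i] that are measurable. *)
Lemma mean_cell_measureE dO (Omega : measurableType dO) (P : probability Omega R)
    (cells : Omega -> set (fell V)) (C : Omega -> set (set V))
    (S : nat -> Omega -> idxset) (N : set Omega) (B : set (fell V)) :
  measurable N -> P N = 0%E -> (forall i, measurable_fun setT (S i)) ->
  (forall o, ~ N o -> [/\ forall Q, C o Q -> is_open_cell W Q,
     forall Q Q', C o Q -> C o Q' -> Q `&` Q' !=set0 -> Q = Q',
     cells o = [set c : fell V | cset c !=set0 /\ exists2 Q, C o Q & cset c = closure Q] &
     forall i, S i o = index_set (C o) i]) ->
  measurable B ->
  mean_cell_measure P cells (B `&` cell_space W) =
  (\sum_(i <oo) P (S i @^-1` (least_index i `&` closed_hull @^-1` B)))%E.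
Proof.
move=> mN N0 mS CS mB.
have mE i : measurable (least_index i `&` closed_hull @^-1` B).
  apply: measurableI; first exact: measurable_least_index.
  by rewrite -[X in measurable X]setTI; exact: measurable_closed_hull.
have mSE i : measurable (S i @^-1` (least_index i `&` closed_hull @^-1` B)).
  by rewrite -[X in measurable X]setTI; exact: mS.
rewrite /mean_cell_measure.
rewrite (@eq_integral_negligible _ _ _ P _ (fun o =>
  \sum_(i <oo) (\1_(least_index i `&` closed_hull @^-1` B) (S i o))%:E)%E N)//.
- rewrite integral_nneseries//; last first.
    by move=> i; apply/measurable_EFinP; exact: (measurable_indic (mSE i)).
  apply: eq_eseriesr => i _.
  transitivity (\int[P]_o (\1_(S i @^-1` (least_index i `&` closed_hull @^-1` B)) o)%:E)%E => //.
  by rewrite integral_indic// setIT.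
- by move=> o; apply: esum_ge0 => c _; rewrite diracE lee_fin.
- by move=> o; apply: nneseries_ge0 => i _ _; rewrite lee_fin.
- move=> o /CS[Cc Cd -> SE]; rewrite (esum_cells Cc Cd).
  by apply: eq_eseriesr => i _; rewrite SE.
Qed.

End counting_cells.

(** * Stars of segments and the planes that hit them *)

Section stars.
Variables (R : realType) (d : nat).
Notation V := 'rV[R]_d.+1.
Variables (W : set V) (x : nat -> V).
Hypotheses (W_compact : compact W) (cW : segconvex W).
Hypothesis xW : forall i, W (x i).

(** The head of [i :: J] contributes the degenerate segment at the centre, so that the star is never
    empty. *)
Definition star (i : nat) (J : seq nat) : set V :=
  \bigcup_(j in [set j | j \in i :: J]) seg (x i) (x j).

Lemma hit_star i J : @hit R d (star i J) =
  \bigcup_(j in [set j | j \in i :: J]) hit (seg (x i) (x j)).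
Proof.
apply/seteqP; split => H.
  by move=> [z [Hz [j jJ jz]]]; exists j => //; exists z.
by move=> [j jJ [z [Hz jz]]]; exists z; split => //; exists j.
Qed.

Lemma measurable_hit_star i J : measurable (@hit R d (star i J)).
Proof.
by rewrite hit_star; apply: bigcup_measurable => j _; exact/measurable_hit_compact/compact_seg.
Qed.

Lemma star_sub i J : star i J `<=` W.
Proof. by move=> z [j _]; exact: cW. Qed.

Lemma hitS (A B : set V) : A `<=` B -> @hit R d A `<=` hit B.
Proof. by move=> AB H [z [Hz /AB Bz]]; exists z. Qed.

Lemma hit_lty (Lambda : {measure set (hyp R d) -> \bar R}) (A : set V) :
  locally_finite_hyp Lambda -> A `<=` W -> measurable (@hit R d A) ->
  (Lambda (hit A) < +oo)%E.
Proof.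
move=> Lambda_lf AW mA; have mW := measurable_hit_compact W_compact.
apply: (@le_lt_trans _ _ (Lambda (hit W))).
  by apply: le_measure; rewrite ?inE//; exact: hitS.
by apply: Lambda_lf => //; exact: compact_bounded.
Qed.

End stars.

(** * Connected components of the complement of a family of planes *)

Section poisson_cells.
Variables (R : realType) (d : nat).
Notation V := 'rV[R]_d.+1.
Variables (W : set V) (cW : segconvex W).

Variable E : set (hyp R d).
Let U := W `\` \bigcup_(H in E) points H.

Definition unseparated (y z : V) := forall H, E H -> seg y z `&` points H = set0.

Lemma unseparated_start y z : W y -> unseparated y z -> U y.
Proof.
move=> Wy yz; split => // -[H EH Hy].
have : (seg y z `&` points H) y by split => //; exact: seg_start.
by rewrite (yz _ EH).
Qed.

Lemma component_unseparated y : U y ->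
  connected_component U y = W `&` [set z | unseparated y z].
Proof.
move=> Uy; apply/seteqP; split => z.
  move=> yz; have [Wz Ez] := connected_component_sub yz; split => // H EH.
  have [b by_] : exists b, side b H y.
    by have [|hy|hy] := @side_cover _ _ H y; [move=> Hy; apply: Uy.2; exists H|exists true|exists false].
  suff bz : side b H z.
    rewrite -subset0 => w [yzw Hw].
    by have := side_seg by_ bz yzw => /side_points.
  (* The side containing [y] is clopen in the component: it is open, and there it coincides with the
     closed complement of the opposite side. *)
  suff e : connected_component U y `&` side b H = connected_component U y.
    by move: yz; rewrite -e => -[].
  apply: component_connected.
  - by exists y; split => //; exact: connected_component_refl.
  - by exists (side b H) => //; exact: open_side.
  - exists (~` side (~~ b) H); first by rewrite closedC; exact: open_side.
    apply/seteqP; split => w [Uw hw]; split => //; first exact: side_disj hw.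
    have wH : ~ points H w.
      by move=> Hw; have [_] := connected_component_sub Uw; apply; exists H.
    by have [hw'|hw'] := side_cover wH; case: b {by_} hw => // -[].
move=> [Wz yz]; apply: (@connected_component_max _ U (seg y z)).
- exact: seg_start.
- move=> w yzw; split; first exact: (cW Uy.1 Wz yzw).
  move=> [H EH Hw]; have : (seg y z `&` points H) w by [].
  by rewrite yz.
- exact: connected_seg.
- exact: seg_end.
Qed.

Hypothesis E_fin : finite_set (E `&` hit W).

(** Planes missing [W] separate no points of [W]; each of the finitely many others contributes its
    open half-space around [y]. *)
Lemma is_open_cell_component y : U y -> is_open_cell W (connected_component U y).
Proof.
move=> Uy; have [s sE] := finite_fsetP.1 E_fin.
have inE_ H : (E `&` hit W) H <-> H \in finmap.enum_fset s by rewrite sE.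
rewrite component_unseparated//.
have -> : W `&` [set z | unseparated y z] =
    W `&` [set z | forall H, H \in finmap.enum_fset s -> seg y z `&` points H = set0].
  apply/seteqP; split => z [Wz yz]; split => // H.
    by move=> /inE_[EH _]; exact: yz.
  move=> EH; have [HW|HW] := pselect (hit W H).
    by apply: yz; apply/inE_.
  by rewrite -subset0 => w [yzw Hw]; apply: HW; exists w; split => //; exact: (cW Uy.1 Wz yzw).
have sU : forall H, H \in finmap.enum_fset s -> ~ points H y.
  by move=> H /inE_[EH _] Hy; apply: Uy.2; exists H.
elim: (finmap.enum_fset s) sU => [_|H t IHt tU].
  rewrite (_ : [set _ | _] = setT) ?setIT; first exact: is_open_cellW.
  by apply/seteqP; split.
have [b by_] : exists b, side b H y.
  by have [hy|hy] := side_cover (tU H (mem_head _ _)); [exists true|exists false].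
rewrite (_ : _ `&` _ = (W `&` [set z | forall H', H' \in t -> seg y z `&` points H' = set0])
    `&` side b H).
  by apply: is_open_cell_side; apply: IHt => H' H't; apply: tU; rewrite inE H't orbT.
apply/seteqP; split => z [].
  move=> Wz yz; split; first by split => // H' H't; apply: yz; rewrite inE H't orbT.
  by apply: seg_same_side by_ _; apply: yz; exact: mem_head.
move=> [Wz yz] bz; split => // H'; rewrite inE => /orP[/eqP ->|]; last exact: yz.
by rewrite -subset0 => w [yzw Hw]; have /side_points := side_seg by_ bz yzw.
Qed.

End poisson_cells.

(** * Void probabilities and finiteness of a Poisson process *)

Section poisson_void.
Variables (R : realType) (d : nat) (dO : measure_display) (Omega : measurableType dO).
Variables (P : probability Omega R) (eta : Omega -> set (hyp R d)).
Variable M : {measure set (hyp R d) -> \bar R}.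
Hypothesis eta_poisson : is_poisson_process P eta M.
Implicit Types (B : set (hyp R d)) (o : Omega).

Lemma npoints_eq0 B o : npoints eta B o = 0%E <-> eta o `&` B = set0.
Proof.
rewrite /npoints /counting; split => [|->]; last by rewrite asboolT// fset_set0.
case: ifPn => // /asboolP fB [/eqP]; rewrite pnatr_eq0 finmap.cardfs_eq0 => /eqP e.
by rewrite -(fset_setK fB) e set_fset0.
Qed.

Lemma npoints_nat_or_pinfty B o :
  (exists k : nat, npoints eta B o = k%:R%:E) \/ npoints eta B o = +oo%E.
Proof. by rewrite /npoints /counting; case: ifPn => _; [left; eexists|right]. Qed.

Lemma poisson_void B : measurable B -> (M B < +oo)%E ->
  P [set o | eta o `&` B = set0] = (expR (- fine (M B)))%:E.
Proof.
move=> mB MB; have [_ /(_ B mB) + _] := eta_poisson.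
rewrite /poisson_law lt_eqF// => /(_ 0%N).
rewrite (_ : [set o | _] = [set o | eta o `&` B = set0]); last first.
  by apply/seteqP; split => o /npoints_eq0.
move=> ->; rewrite /poisson_prob; case: ifPn => [M0|].
  by rewrite esum_set1 ?lee_fin ?poisson_pmf_ge0// /poisson_pmf M0 expr0 fact0 invr1 !mul1r.
(* For a rate that is not positive [poisson_prob] is the Dirac mass at 0, in agreement with
   [expR 0 = 1]. *)
rewrite -leNgt => M0; rewrite diracE mem_set//.
suff -> : fine (M B) = 0 by rewrite oppr0 expR0.
by apply/eqP; rewrite eq_le M0 fine_ge0.
Qed.

(** The Poisson law already gives the finite counts total mass one. *)
Lemma poisson_finite B : measurable B -> (M B < +oo)%E ->
  P [set o | npoints eta B o = +oo%E] = 0%E.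
Proof.
move=> mB MB; have [mN /(_ B mB) + _] := eta_poisson.
rewrite /poisson_law lt_eqF// => PN.
have mNB : measurable_fun setT (npoints eta B) := mN _ mB.
pose F k := [set o | npoints eta B o = k%:R%:E].
have mF k : measurable (F k).
  rewrite -[X in measurable X]setTI; exact: (mNB measurableT [set k%:R%:E]).
have PF : P (\bigcup_k F k) = 1%E.
  rewrite measure_bigcup//=; last first.
    move=> i j _ _ [w [/= oi oj]]; apply/eqP; rewrite -(eqr_nat R).
    by move: oi oj; rewrite /F/= => -> [->].
  rewrite -(@probability_setT _ _ _ (poisson_prob (fine (M B)) 0)).
  rewrite [X in _ = poisson_prob _ _ X](_ : _ = \bigcup_k [set k]); last first.
    by apply/seteqP; split => k // _; exists k.
  rewrite measure_bigcup//=; last by move=> i j _ _ [k [/= -> ->]].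
  by apply: eq_eseriesr => k _; exact: PN.
rewrite (_ : [set o | _] = ~` \bigcup_k F k).
  rewrite probability_setC; last exact: bigcupT_measurable.
  by rewrite PF subee.
apply/seteqP; split => o /=.
  by move=> oy [k _]; rewrite /F/= oy.
by move=> oF; have [[k ok]|//] := npoints_nat_or_pinfty B o; exfalso; apply: oF; exists k.
Qed.

End poisson_void.

(** * The law of the index sets for the Poisson tessellation *)

Section poisson_tessellation.
Variables (R : realType) (d : nat).
Notation V := 'rV[R]_d.+1.
Variables (W : set V) (x : nat -> V).
Hypotheses (W_compact : compact W) (cW : segconvex W).
Hypothesis xW : forall i, W (x i).
Hypothesis xd : forall G, open G -> W `&` G !=set0 -> exists i, G (x i).
Variable Lambda : {measure set (hyp R d) -> \bar R}.
Hypothesis Lambda_lf : locally_finite_hyp Lambda.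
Variables (t : R) (t_gt0 : 0 < t).
Variables (dO : measure_display) (Omega : measurableType dO).
Variables (P : probability Omega R) (eta : Omega -> set (hyp R d)).
Let M : {measure set (hyp R d) -> \bar R} := mscale (NngNum (ltW t_gt0)) Lambda.
Hypothesis eta_poisson : is_poisson_process P eta M.

Definition unseparated_from i o : idxset :=
  [set j | unseparated (eta o) (x i) (x j)].

(** For empty [J] the cylinder is the whole space, while the star is the single point [x i], through
    which planes may pass. *)
Lemma unseparated_from_cylinder i J : J != [::] ->
  unseparated_from i @^-1` cylinder J = [set o | eta o `&` hit (star x i J) = set0].
Proof.
move=> J0; apply/seteqP; split => o.
  move=> h; rewrite /= -subset0 hit_star => H [EH [j jJ [z [Hz jz]]]].
  have [jJ'|jJ'] := boolP (j \in J).
    have : (seg (x i) (x j) `&` points H) z by [].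
    by rewrite (h _ jJ').
  move: jJ; rewrite /= inE (negbTE jJ') orbF => /eqP ji.
  (* The centre is the starting point of the segment towards any index of [J], so no plane passes
     through it. *)
  case: J h {jJ'} J0 => // k J h _.
  have : (seg (x i) (x k) `&` points H) z.
    split => //; move: jz; rewrite ji => -[s _ ->].
    by rewrite subrr scaler0 addr0; exact: seg_start.
  by rewrite (h _ (mem_head _ _)).
move=> h j jJ H EH; rewrite -subset0 => z [jz Hz].
have : (eta o `&` hit (star x i J)) H.
  by split => //; exists z; split => //; exists j => //=; rewrite inE jJ orbT.
by rewrite h.
Qed.

Lemma hit_star_lty i J : (Lambda (hit (star x i J)) < +oo)%E.
Proof.
apply: (hit_lty W_compact) => //; first exact: star_sub.
exact: measurable_hit_star.
Qed.

Lemma mscale_lty (A : set (hyp R d)) : (Lambda A < +oo)%E -> (M A < +oo)%E.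
Proof. by move=> LA; rewrite /M/= /mscale/= lte_mul_pinfty// lee_fin ltW. Qed.

Lemma measurable_unseparated_from i : measurable_fun setT (unseparated_from i).
Proof.
apply: measurable_fun_idxset => J.
have [->|J0] := eqVneq J [::].
  by rewrite (_ : _ @^-1` _ = setT); [exact: measurableT|apply/seteqP; split].
rewrite unseparated_from_cylinder//.
have [mN _ _] := eta_poisson.
have := mN _ (measurable_hit_star x i J) measurableT [set 0%E] (emeasurable_set1 _).
by rewrite setTI; congr measurable; apply/seteqP; split => o /npoints_eq0.
Qed.

Lemma unseparated_from_law i J : J != [::] ->
  P (unseparated_from i @^-1` cylinder J) =
  (expR (- (t * fine (Lambda (hit (star x i J))))))%:E.
Proof.
move=> J0; rewrite unseparated_from_cylinder// (poisson_void eta_poisson).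
- by rewrite /M/= /mscale/= fineM// ge0_fin_numE// hit_star_lty.
- exact: measurable_hit_star.
- exact/mscale_lty/hit_star_lty.
Qed.

(** The exceptional null event is that infinitely many planes hit [W]. *)
Lemma mean_pht_cells B : measurable B ->
  mean_cell_measure P (pht_cells W eta) (B `&` cell_space W) =
  (\sum_(i <oo) P (unseparated_from i @^-1`
     (least_index i `&` closed_hull x @^-1` B)))%E.
Proof.
have mW := @measurable_hit_compact R d _ W_compact.
have clW : closed W by apply: compact_closed => //; exact: norm_hausdorff.
pose U o := W `\` \bigcup_(H in eta o) points H.
apply: (@mean_cell_measureE _ _ W x clW cW xW xd _ _ _ _
  (fun o => connected_component (U o) @` U o) _ [set o | npoints eta (hit W) o = +oo%E]).
- rewrite -[X in measurable X]setTI; have [mN _ _] := eta_poisson.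
  exact: (mN _ mW measurableT [set +oo%E]).
- apply: (poisson_finite eta_poisson) => //.
  by apply/mscale_lty/(hit_lty W_compact).
- exact: measurable_unseparated_from.
- move=> o No; have fE : finite_set (eta o `&` hit W).
    by apply: contrapT => nf; apply: No; rewrite /= /npoints /counting asboolF.
  split.
  + by move=> _ [y Uy <-]; exact: is_open_cell_component.
  + move=> _ _ [y Uy <-] [z Uz <-] [w [yw zw]].
    by rewrite (same_connected_component yw) (same_connected_component zw).
  + apply/seteqP; split => c [].
      move=> y Uy cE; split; last by exists (connected_component (U o) y) => //; exists y.
      by exists y; rewrite cE; apply: subset_closure; exact: connected_component_refl.
    by move=> c0 [_ [y Uy <-] cE]; exists y.
  + move=> i; apply/seteqP; split => j.
      move=> ij; have Ui := unseparated_start (xW i) ij.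
      exists (connected_component (U o) (x i)); first by exists (x i).
      split; first exact: connected_component_refl.
      by rewrite component_unseparated.
    move=> [_ [y Uy <-]] [yi yj].
    have : connected_component (U o) (x i) (x j).
      by apply: connected_component_trans yj; exact: connected_component_sym.
    rewrite component_unseparated//; last exact: connected_component_sub yi.
    by case.
Qed.

End poisson_tessellation.

(** * Images of measures with a density *)

Section image_density.
Context d1 d2 (T1 : measurableType d1) (T2 : measurableType d2) (R : realType).
Variables (mu : {measure set T1 -> \bar R}) (phi : T1 -> T2) (q : T1 -> R).
Hypotheses (mphi : measurable_fun setT phi) (mq : measurable_fun setT q).
Hypothesis q0 : forall x, 0 <= q x.
Local Open Scope ereal_scope.

(** The image under [phi] of the measure with density [q] with respect to [mu]. The hypotheses are
    carried as arguments so that the measure structure can be attached to the term. *)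
Definition image_dens of measurable_fun setT phi & measurable_fun setT q &
    (forall x, (0 <= q x)%R) :=
  fun A : set T2 => \int[mu]_(x in phi @^-1` A) (q x)%:E.

Local Notation nu := (image_dens mphi mq q0).

Let mphiV A : measurable A -> measurable (phi @^-1` A).
Proof. by move=> mA; rewrite -[X in measurable X]setTI; exact: mphi. Qed.

Let nu0 : nu set0 = 0.
Proof. by rewrite /image_dens preimage_set0 integral_set0. Qed.

Let nu_ge0 A : 0 <= nu A.
Proof. by apply: integral_ge0 => x _; rewrite lee_fin. Qed.

Let nu_sigma_additive : semi_sigma_additive nu.
Proof.
move=> F mF tF mUF; rewrite /image_dens preimage_bigcup; apply: cvg_toP.
  apply: ereal_nondecreasing_is_cvgn => m n mn.
  apply: lee_sum_nneg_natr => // k _ _; exact: nu_ge0.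
rewrite ge0_integral_bigcup//=.
- by move=> k; exact: mphiV.
- exact/measurable_funTS/measurable_EFinP.
- by move=> x _; rewrite lee_fin.
- by apply/trivIsetP => i j _ _ ij; rewrite -preimage_setI; move/trivIsetP: tF => ->; rewrite ?preimage_set0.
Qed.

HB.instance Definition _ := isMeasure.Build _ _ _ nu nu0 nu_ge0 nu_sigma_additive.

Import HBNNSimple.

Let integral_image_dens_nnsfun (h : {nnsfun T2 >-> R}) :
  \int[nu]_y (h y)%:E = \int[mu]_x ((h (phi x))%:E * (q x)%:E).
Proof.
transitivity (\int[nu]_x (\sum_(y \in range h) (y * \1_(h @^-1` [set y]) x)%:E)).
  by apply: eq_integral => x _; rewrite /= fimfunE -fsumEFin.
have mi r : measurable_fun setT (fun x => (r * \1_(h @^-1` [set r]) x)%:E).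
  by apply/measurable_EFinP; exact: measurable_funM.
have mi1 r : measurable_fun setT (fun x => (\1_(h @^-1` [set r]) (phi x))%:E : \bar R).
  apply/measurable_EFinP; exact: measurableT_comp.
rewrite ge0_integral_fsum//; last by move=> r x _; exact: nnfun_muleindic_ge0.
transitivity (\int[mu]_x (\sum_(y \in range h)
    (y * \1_(h @^-1` [set y]) (phi x))%:E * (q x)%:E)); last first.
  apply: eq_integral => x _.
  rewrite [in RHS]fimfunE -fsumEFin//.
  by rewrite ge0_mule_fsuml// => r; exact: nnfun_muleindic_ge0.
rewrite ge0_integral_fsum//; last 2 first.
- move=> r; apply: emeasurable_funM; last exact/measurable_EFinP.
  by under eq_fun do rewrite EFinM; exact: measurable_funeM.
- by move=> r x _; apply: mule_ge0; [exact: nnfun_muleindic_ge0|rewrite lee_fin].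
apply: eq_fsbigr => r _.
have [r0|r0] := ltP r 0%R.
  rewrite preimage_nnfun0// indic0.
  by rewrite !integral0_eq// => x _; rewrite mulr0 ?mul0e.
under eq_integral do rewrite EFinM.
rewrite ge0_integralZl//; last exact/measurable_EFinP.
rewrite integral_indic// setIT.
under [RHS]eq_integral do rewrite EFinM -muleA.
rewrite ge0_integralZl//; last 2 first.
- by apply: emeasurable_funM => //; exact/measurable_EFinP.
- by move=> x _; apply: mule_ge0; rewrite lee_fin.
congr (_ * _); rewrite /= /image_dens integral_mkcond; apply: eq_integral => x _.
rewrite patchE indicE; have -> : (x \in phi @^-1` (h @^-1` [set r])) = (phi x \in h @^-1` [set r]).
  by apply/idP/idP; rewrite !inE.
by case: ifPn; rewrite ?mul1e ?mul0e.
Qed.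

Lemma integral_image_dens (f : T2 -> \bar R) :
  measurable_fun setT f -> (forall y, 0 <= f y) ->
  \int[nu]_y f y = \int[mu]_x (f (phi x) * (q x)%:E).
Proof.
move=> mf f0; pose h := nnsfun_approx measurableT mf.
have hf x : EFin \o h ^~ x @ \oo --> f x by exact: cvg_nnsfun_approx.
have mh n : measurable_fun setT (EFin \o h n) by exact/measurable_EFinP.
transitivity (limn (fun n => \int[nu]_x (h n x)%:E)).
  rewrite -monotone_convergence//.
  - by apply: eq_integral => x _; apply/esym/cvg_lim => //; exact: hf.
  - by move=> n x _; rewrite lee_fin.
  - by move=> x _ a b ab; rewrite lee_fin; exact/lefP/nd_nnsfun_approx.
under eq_fun do rewrite integral_image_dens_nnsfun.
rewrite -monotone_convergence//.
- apply: eq_integral => x _; apply/cvg_lim => //.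
  by apply: cvgeZr => //; exact: hf.
- move=> n; apply: emeasurable_funM; last exact/measurable_EFinP.
  exact: (measurableT_comp (mh n) mphi).
- by move=> n x _; rewrite mule_ge0 ?lee_fin.
- move=> x _ a b ab; rewrite lee_wpmul2r ?lee_fin//.
  exact/lefP/nd_nnsfun_approx.
Qed.

Lemma image_densE E : measurable E ->
  nu E = \int[mu]_x ((\1_E (phi x))%:E * (q x)%:E).
Proof.
move=> mE; rewrite -(integral_image_dens (f := fun z => (\1_E z)%:E)).
- by rewrite integral_indic// setIT.
- exact/measurable_EFinP/measurable_indic.
- by move=> z; rewrite lee_fin.
Qed.

End image_density.

(** * Exponential integrals *)

Section exponential_integrals.
Variable R : realType.
Notation leb := (@lebesgue_measure R).
Local Open Scope ereal_scope.

Lemma integral_expR_itv0c (a r : R) : (0 <= a)%R -> (0 <= r)%R ->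
  \int[leb]_(l in `[0%R, r]) (a * expR (- a * l))%:E = (1 - expR (- a * r))%:E.
Proof.
move=> a0 r0; have [->|an0] := eqVneq a 0%R.
  rewrite oppr0 mul0r expR0 subrr; apply: integral0_eq => l _.
  by rewrite mul0r.
have [->|rn0] := eqVneq r 0%R.
  by rewrite mulr0 expR0 subrr set_itv1 integral_set1.
have r_gt0 : (0 < r)%R by rewrite lt_neqAle eq_sym rn0.
rewrite EFinB -exponential_prob_itv0c// /exponential_prob.
apply: eq_integral => l; rewrite inE/= in_itv/= => /andP[l0 _].
by rewrite exponential_pdfE.
Qed.

Lemma integral_expR_itv0y (a : R) : (0 < a)%R ->
  \int[leb]_(l in `[0%R, +oo[) (a * expR (- a * l))%:E = 1.
Proof.
move=> a0; rewrite -(integral_exponential_pdf a0) integral_mkcond.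
by apply: eq_integral => l _; rewrite /exponential_pdf !patchE; case: ifPn.
Qed.

End exponential_integrals.

(** * From a formula on rectangles to integrals of functions *)

Section disintegration.
Context dO (Omega : measurableType dO) (R : realType) (P : probability Omega R).
Context dS (S : measurableType dS).
Notation TR := (measurableTypeR R).
Notation leb := (@lebesgue_measure R).
Variables (X : Omega -> S) (Y : Omega -> TR) (A D : set Omega) (q : Omega * TR -> R).
Hypotheses (mX : measurable_fun setT X) (mY : measurable_fun setT Y).
Hypotheses (mA : measurable A) (mD : measurable D).
Hypotheses (mq : measurable_fun setT q) (q0 : forall z, 0 <= q z).
Local Open Scope ereal_scope.
Hypothesis PDE : forall E1 E2, measurable E1 -> measurable E2 ->
  P (D `&` X @^-1` E1 `&` Y @^-1` E2) =
  \int[P]_(o in A `&` X @^-1` E1) \int[leb]_(l in E2) (q (o, l))%:E.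

Let qA (z : Omega * TR) : R := (\1_A z.1 * q z)%R.

Let mqA : measurable_fun setT qA.
Proof.
apply: measurable_funM => //.
by apply: measurableT_comp => //; exact: measurable_indic.
Qed.

Let qA0 z : (0 <= qA z)%R. Proof. by rewrite mulr_ge0. Qed.

Let phi1 (o : Omega) : S * TR := (X o, Y o).
Let phi2 (z : Omega * TR) : S * TR := (X z.1, z.2).

Let mphi1 : measurable_fun setT phi1.
Proof. exact: measurable_fun_pair. Qed.

Let mphi2 : measurable_fun setT phi2.
Proof. by apply: measurable_fun_pair => //; exact: measurableT_comp. Qed.

Let m1D : measurable_fun setT (\1_D : Omega -> R).
Proof. exact: measurable_indic. Qed.

Let D0 o : (0 <= \1_D o :> R)%R. Proof. by []. Qed.

Let integral_qA (f : S * TR -> \bar R) : measurable_fun setT f -> (forall z, 0 <= f z) ->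
  \int[P \x leb]_z (f (phi2 z) * (qA z)%:E) =
  \int[P]_(o in A) \int[leb]_l (f (X o, l) * (q (o, l))%:E).
Proof.
move=> mf f0.
have mfq : measurable_fun setT (fun z => f (phi2 z) * (qA z)%:E).
  by apply: emeasurable_funM; [exact: measurableT_comp|exact/measurable_EFinP].
have fq0 z : 0 <= f (phi2 z) * (qA z)%:E by rewrite mule_ge0// lee_fin.
transitivity (\int[P]_o \int[leb]_l (f (phi2 (o, l)) * (qA (o, l))%:E)).
  exact: (@fubini_tonelli1 _ _ _ _ R P leb (fun z => f (phi2 z) * (qA z)%:E) mfq fq0).
rewrite [RHS]integral_mkcond; apply: eq_integral => o _.
rewrite patchE; case: ifPn => oA.
  by apply: eq_integral => l _; rewrite /qA/= indicE oA mul1r.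
by apply: integral0_eq => l _; rewrite /qA/= indicE (negbTE oA) mul0r mule0.
Qed.

Let integral_D (f : S * TR -> \bar R) :
  \int[P]_o (f (phi1 o) * (\1_D o)%:E) = \int[P]_(o in D) f (phi1 o).
Proof.
rewrite [RHS]integral_mkcond; apply: eq_integral => o _.
by rewrite patchE indicE; case: ifPn; rewrite ?mule1 ?mule0.
Qed.

Local Notation m1 := (image_dens P mphi1 m1D D0).
Local Notation m2 := (image_dens (P \x leb) mphi2 mqA qA0).

Let m12 E : measurable E -> m1 E = m2 E.
Proof.
pose G := [set E | exists E1, measurable E1 /\ exists E2, measurable E2 /\ E = E1 `*` E2] : set (set (S * TR)).
apply: (@measure_unique _ R (S * TR)%type G (fun=> setT) _ _ _ _
  (image_dens P mphi1 m1D D0) (image_dens (P \x leb) mphi2 mqA qA0)).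
- rewrite measurable_prod_measurableType //; congr (<<s _ >>).
  rewrite predeqE => F; split => [[E1 mE1 [E2 mE2 <-]]|[E1 [mE1 [E2 [mE2 ->]]]]].
    by exists E1; split => //; exists E2.
  by exists E1 => //; exists E2.
- move=> _ _ [E1 [mE1 [E2 [mE2 ->]]]] [F1 [mF1 [F2 [mF2 ->]]]].
  rewrite -setXI; exists (E1 `&` F1); split; first exact: measurableI.
  by exists (E2 `&` F2); split => //; exact: measurableI.
- by move=> _; exists setT; split => //; exists setT; split => //; rewrite setXTT.
- by apply/seteqP; split => // z _; exists 0%N.
- move=> _ [E1 [mE1 [E2 [mE2 ->]]]].
  have mE12 : measurable (E1 `*` E2) by exact: measurableX.
  have mX1 : measurable (X @^-1` E1) by rewrite -[X in measurable X]setTI; exact: mX.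
  have mY2 : measurable (Y @^-1` E2) by rewrite -[X in measurable X]setTI; exact: mY.
  rewrite /= !image_densE// (integral_D (fun z => (\1_(E1 `*` E2) z)%:E))
    (integral_qA (f := fun z => (\1_(E1 `*` E2) z)%:E))//; last first.
    exact/measurable_EFinP/measurable_indic.
  transitivity (P (D `&` X @^-1` E1 `&` Y @^-1` E2)).
    transitivity (\int[P]_(o in D) (\1_(X @^-1` E1 `&` Y @^-1` E2) o)%:E); first by [].
    rewrite integral_indic; [|by []|exact: measurableI].
    by rewrite setIC setIA.
  rewrite PDE// integral_mkcondr; apply: eq_integral => o _.
  rewrite patchE; have [oE1|oE1] := boolP (o \in X @^-1` E1).
    rewrite integral_mkcond; apply: eq_integral => l _; rewrite patchE indicE.
    move: oE1; rewrite inE/= => oE1.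
    have -> : ((X o, l) \in E1 `*` E2) = (l \in E2).
      by apply/idP/idP; rewrite !inE/=; [case|split].
    by case: ifPn; rewrite ?mul1e ?mul0e.
  rewrite integral0_eq// => l _; rewrite indicE memNset ?mul0e// => -[/= XE1 _].
  by move: oE1; rewrite notin_setE; apply.
- move=> _; rewrite /= image_densE// (integral_D (fun z => (\1_setT z)%:E)).
  rewrite (_ : (fun _ => _) = (fun o => (\1_setT o)%:E)); last by apply/funext => o; rewrite !indicT.
  rewrite integral_indic// setTI.
  by apply: le_lt_trans (ltry 1); exact: probability_le1.
Qed.

(** The law of [(X, Y)] on [D] and the image of the product measure with density [q] over [A] agree
    on rectangles by [PDE], hence everywhere, and so integrate [f] alike. *)
Lemma disintegration (f : S * TR -> \bar R) :
  measurable_fun setT f -> (forall z, 0 <= f z) ->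
  \int[P]_(o in D) f (X o, Y o) =
  \int[P]_(o in A) \int[leb]_l (f (X o, l) * (q (o, l))%:E).
Proof.
move=> mf f0; rewrite -integral_qA// -(integral_image_dens (P \x leb) mphi2 mqA qA0)//.
rewrite -(integral_D f) -(integral_image_dens P mphi1 m1D D0)//.
by apply: eq_measure_integral => E mE _; exact: m12.
Qed.

End disintegration.

(** * Cells, rates and conditional laws of the MNW construction *)

Section mnw_cells.
Variables (R : realType) (d : nat).
Notation V := 'rV[R]_d.+1.
Variables (W : set V) (x : nat -> V).
Hypotheses (W_compact : compact W) (cW : segconvex W).
Hypothesis xW : forall i, W (x i).
Hypothesis xd : forall G, open G -> W `&` G !=set0 -> exists i, G (x i).
Variable Lambda : {measure set (hyp R d) -> \bar R}.
Hypothesis Lambda_lf : locally_finite_hyp Lambda.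
Variables (dO : measure_display) (Omega : measurableType dO).
Variable P : probability Omega R.
Variables (L : seq bool -> Omega -> \bar R) (H : seq bool -> Omega -> hyp R d).
Hypothesis LH_mnw : is_mnw Lambda W P L H.
Implicit Types (w v : seq bool) (o : Omega) (A : set Omega) (C : set (hyp R d)).

(** [mnw_cell] without the closures: membership of a fixed point only depends on its sides with
    respect to the ancestral planes, hence is measurable. *)
Fixpoint mnw_open_cell w o : set V :=
  if w is b :: w' then mnw_open_cell w' o `&` side b (H w' o) else W.

Local Notation ocell := mnw_open_cell.
Local Notation cell := (mnw_cell W H).
Local Notation birth := (birth_time L).

Lemma W_closed : closed W.
Proof. by apply: compact_closed => //; exact: norm_hausdorff. Qed.

Lemma mnw_cellE w o : cell w o = closure (ocell w o).
Proof.
elim: w => [|b w IHw] /=; first exact/closure_id/W_closed.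
by rewrite /subcell IHw closureI_open//; exact: open_side.
Qed.

Lemma is_open_cell_mnw w o : is_open_cell W (ocell w o).
Proof.
by elim: w => [|b w IHw] /=; [exact: is_open_cellW|exact: is_open_cell_side].
Qed.

Lemma mnw_cell_sub w o : cell w o `<=` W.
Proof.
rewrite mnw_cellE [X in _ `<=` X]((closure_id W).1 W_closed).
by apply: closureS; apply: is_open_cell_sub; exact: is_open_cell_mnw.
Qed.

Lemma measurable_hit_cell w o : measurable (hit (cell w o)).
Proof.
apply: measurable_hit_compact; apply: (@subclosed_compact _ _ W) => //.
  by rewrite mnw_cellE; exact: closed_closure.
exact: mnw_cell_sub.
Qed.

Lemma hit_cell_lty w o : (Lambda (hit (cell w o)) < +oo)%E.
Proof.
apply: (hit_lty W_compact) => //; first exact: mnw_cell_sub.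
exact: measurable_hit_cell.
Qed.

Lemma measurable_lifetime w : measurable_fun setT (L w). Proof. by have [] := LH_mnw. Qed.

Lemma measurable_splitting w : measurable_fun setT (H w). Proof. by have [_ + _] := LH_mnw; exact. Qed.

(** The sigma-algebra [mnw_past] turned into a measurable type, so that measurability with respect
    to the past obeys the usual closure rules. *)
Definition past (n : nat) : Type := g_sigma_algebraType
  (\bigcup_(v in [set v : seq bool | (size v < n)%N])
     (preimage_set_system setT (L v) measurable `|`
      preimage_set_system setT (H v) measurable)).

HB.instance Definition _ n := Measurable.copy (past n) (g_sigma_algebraType
  (\bigcup_(v in [set v : seq bool | (size v < n)%N])
     (preimage_set_system setT (L v) measurable `|`
      preimage_set_system setT (H v) measurable))).

Lemma mnw_pastE n A : mnw_past L H n A = measurable (A : set (past n)).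
Proof. by []. Qed.

Lemma past_measurable n A : mnw_past L H n A -> measurable A.
Proof.
apply: smallest_sub; first exact: sigma_algebra_measurable.
move=> _ [v _ [[B mB <-]|[B mB <-]]].
- exact: measurable_lifetime.
- exact: measurable_splitting.
Qed.

Lemma past_lifetime n v : (size v < n)%N ->
  measurable_fun setT (L v : past n -> \bar R).
Proof.
move=> vn _ B mB; apply: sub_sigma_algebra; exists v => //; left.
by exists B.
Qed.

Lemma past_splitting n v : (size v < n)%N ->
  measurable_fun setT (H v : past n -> hyp R d).
Proof.
move=> vn _ B mB; apply: sub_sigma_algebra; exists v => //; right.
by exists B.
Qed.

(** Non-strict, unlike the bound for lifetimes: a birth time only involves the lifetimes of proper
    ancestors. *)
Lemma past_birth n w : (size w <= n)%N ->
  measurable_fun setT (birth w : past n -> \bar R).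
Proof.
elim: w => [|b w IHw] wn /=; first exact: measurable_cst.
apply: emeasurable_funD; first by apply: IHw; exact: ltnW.
exact: past_lifetime.
Qed.

Lemma past_open_cell n w y : (size w <= n)%N ->
  measurable ([set o | ocell w o y] : set (past n)).
Proof.
elim: w => [|b w IHw] wn /=.
  have [Wy|Wy] := pselect (W y).
    by rewrite [X in measurable X](_ : _ = setT)//; apply/seteqP; split.
  by rewrite [X in measurable X](_ : _ = set0)//; apply/seteqP; split.
apply: measurableI; first by apply: IHw; exact: ltnW.
rewrite -[X in measurable X]setTI.
exact: (past_splitting wn measurableT (measurable_side b y)).
Qed.

Lemma measurable_birth w : measurable_fun setT (birth w).
Proof.
move=> _ B mB; apply: (@past_measurable (size w)); rewrite mnw_pastE.
exact: (past_birth (leqnn _)).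
Qed.

Lemma measurable_open_cell w y : measurable [set o | ocell w o y].
Proof. by apply: (@past_measurable (size w)); rewrite mnw_pastE; exact: past_open_cell. Qed.

Lemma hit_cellP w o h : hit (cell w o) h <->
  forall k : nat, exists i, ocell w o (x i) /\ hit (ball (x i) k.+1%:R^-1) h.
Proof.
rewrite mnw_cellE; apply: (@hit_closure _ _ W _ _ x W_compact).
  by apply: is_open_cell_sub; exact: is_open_cell_mnw.
by move=> G oG Gw; exact: (open_cell_dense xW xd (is_open_cell_mnw w o) oG Gw).
Qed.

(** This is the measure of a section of a set which [hit_cellP] writes as a countable combination of
    rectangles. [Lambda] is restricted to [hit W] to make it finite, and every cell lies in [W]. *)
Lemma measurable_Lambda_hit_cell C w : measurable C ->
  measurable_fun setT (fun o => Lambda (C `&` hit (cell w o))).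
Proof.
move=> mC; have mW := @measurable_hit_compact R d _ W_compact.
have Wy : (Lambda (hit W) < +oo)%E by exact: (hit_lty W_compact).
pose LW : {finite_measure set (hyp R d) -> \bar R} := mfrestr mW Wy.
pose Q := [set z : Omega * hyp R d | C z.2 /\ hit (cell w z.1) z.2].
have mQ : measurable Q.
  rewrite (_ : Q = (setT `*` C) `&` \bigcap_k \bigcup_i
      ([set o | ocell w o (x i)] `*` hit (ball (x i) k.+1%:R^-1))).
    apply: measurableI; first exact: measurableX.
    apply: bigcapT_measurable => k; apply: bigcupT_measurable => i.
    apply: measurableX; first exact: measurable_open_cell.
    by apply: measurable_hit_open; exact: ball_open.
  apply/seteqP; split => -[u h] /=.
    move=> [Ch /hit_cellP oh]; split => // k _.
    by have [i [oi ih]] := oh k; exists i.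
  by move=> [[_ Ch] oh]; split => //; apply/hit_cellP => k; have [i _ []] := oh k I; exists i.
rewrite (_ : (fun o => _) = LW \o xsection Q); first exact: measurable_fun_xsection.
apply/funext => o /=; rewrite /LW/= /mfrestr /mrestr; congr (Lambda _).
apply/seteqP; split => h.
  move=> [Ch oh]; split; first by rewrite /xsection/= inE.
  exact: hitS (@mnw_cell_sub w o) _ oh.
by move=> [+ _]; rewrite /xsection/= inE.
Qed.

Lemma lifetime_lawT w o : lifetime_law Lambda (cell w o) setT = 1%E.
Proof.
rewrite /lifetime_law; case: ifPn => [_|l0]; first by rewrite diracT.
rewrite /exponential_prob preimage_setT integral_exponential_pdf//.
by rewrite fine_gt0// hit_cell_lty lt0e l0 measure_ge0.
Qed.

Lemma split_lawT w o : split_law Lambda (cell w o) setT = 1%E.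
Proof.
rewrite /split_law; case: ifPn => // l0; rewrite setTI divff//.
by rewrite gt_eqF// fine_gt0// hit_cell_lty lt0e l0 measure_ge0.
Qed.

(** The law of a single step: the other words of the same generation get [setT], and their factors
    are total masses, equal to 1. *)
Lemma mnw_step w A (B : set (\bar R)) C : mnw_past L H (size w) A ->
  measurable B -> measurable C ->
  P (A `&` [set o | B (L w o) /\ ((L w o < +oo)%E -> C (H w o))]) =
  (\int[P]_(o in A) (lifetime_law Lambda (cell w o) B * split_law Lambda (cell w o) C))%E.
Proof.
move=> pA mB mC; have [_ _ +] := LH_mnw.
pose w' := in_tuple w.
pose B' (v : (size w).-tuple bool) := if v == w' then B else setT.
pose C' (v : (size w).-tuple bool) := if v == w' then C else setT.
have mB' u : measurable (B' u) by rewrite /B'; case: ifPn.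
have mC' u : measurable (C' u) by rewrite /C'; case: ifPn.
move=> /(_ _ A B' C' pA mB' mC') mnwE.
have <- : [set o | forall v : (size w).-tuple bool,
      B' v (L v o) /\ ((L v o < +oo)%E -> C' v (H v o))] =
    [set o | B (L w o) /\ ((L w o < +oo)%E -> C (H w o))].
  apply/seteqP; split => o /= h.
    by have := h w'; rewrite /B' /C' eqxx.
  by move=> v; rewrite /B' /C'; case: ifPn => [/eqP ->|].
rewrite mnwE; apply: eq_integral => o _.
rewrite (bigD1 w')//= big1 ?mule1; first by rewrite /B' /C' eqxx.
by move=> v vw; rewrite /B' /C' (negbTE vw) lifetime_lawT split_lawT mule1.
Qed.

Lemma lifetime_ge0 w : P [set o | (L w o < 0)%E] = 0%E.
Proof.
have mB : measurable [set y : \bar R | (y < 0)%E].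
  rewrite (_ : [set _ | _] = `]-oo, 0%E[%classic); first exact: emeasurable_itv.
  by apply/seteqP; split => y /=; rewrite in_itv.
have pT : mnw_past L H (size w) setT by rewrite mnw_pastE; exact: measurableT.
have := mnw_step pT mB (measurableT : measurable (setT : set (hyp R d))).
rewrite setTI => e; transitivity (P [set o | (L w o < 0)%E /\ ((L w o < +oo)%E -> setT (H w o))]).
  by congr (P _); apply/seteqP; split => o /= => [h|[]].
rewrite {}e; apply: integral0_eq => o _.
rewrite /lifetime_law; case: ifPn => [_|l0].
  by rewrite diracE memNset ?mul0e//= => /ltW; rewrite leNgt ltry.
rewrite /exponential_prob integral0_eq ?mul0e// => l /=.
by rewrite lte_fin => l1; rewrite lt0_exponential_pdf.
Qed.

Definition hit_rate C w o : R := fine (Lambda (C `&` hit (cell w o))).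

Lemma hit_rateE C w o : measurable C ->
  (hit_rate C w o)%:E = Lambda (C `&` hit (cell w o)).
Proof.
move=> mC; rewrite fineK// ge0_fin_numE//; apply: le_lt_trans (hit_cell_lty w o).
by apply: le_measure; rewrite ?inE//; [apply: measurableI => //|]; exact: measurable_hit_cell.
Qed.

Lemma hit_rate_ge0 C w o : 0 <= hit_rate C w o. Proof. exact: fine_ge0. Qed.

Lemma measurable_hit_rate C w : measurable C -> measurable_fun setT (hit_rate C w).
Proof.
move=> mC; apply: (measurableT_comp (fine_measurable measurableT)).
exact: measurable_Lambda_hit_cell.
Qed.

Local Notation rate := (hit_rate setT).

(** The exponential density with rate [r] times the probability of a plane in [C], with [r]
    cancelled. It stays correct for [r = 0], where the lifetime is infinite and the density
    vanishes. *)
Definition step_density C w (z : Omega * measurableTypeR R) : R :=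
  hit_rate C w z.1 * (expR (- rate w z.1 * z.2) * \1_(`[0, +oo[%classic : set R) z.2).

Lemma step_density_ge0 C w z : 0 <= step_density C w z.
Proof. by rewrite !mulr_ge0// ?hit_rate_ge0// expR_ge0. Qed.

Lemma measurable_step_density C w : measurable C -> measurable_fun setT (step_density C w).
Proof.
move=> mC; apply: measurable_funM.
  by apply: measurableT_comp => //; exact: measurable_hit_rate.
apply: measurable_funM.
  apply: measurableT_comp => //; apply: measurable_funM => //.
  apply: measurableT_comp => //; apply: measurableT_comp => //.
  exact: measurable_hit_rate.
by apply: measurableT_comp => //; exact: measurable_indic.
Qed.

Lemma lifetime_split_law C w o (E : set R) : measurable C -> measurable E ->
  (lifetime_law Lambda (cell w o) (EFin @` E) * split_law Lambda (cell w o) C =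
   \int[lebesgue_measure]_(l in E) (step_density C w (o, l))%:E)%E.
Proof.
move=> mC mE; rewrite /lifetime_law /split_law.
have rE := hit_rateE w o measurableT; rewrite setTI in rE.
have cE := hit_rateE w o mC.
case: ifPn => [/eqP l0|l0].
  rewrite mule1 diracE memNset; last by case.
  rewrite integral0_eq// => l _; rewrite /step_density/=.
  suff -> : hit_rate C w o = 0 by rewrite mul0r.
  apply/eqP; rewrite -eqe cE eq_le measure_ge0 andbT.
  apply: (@le_trans _ _ (Lambda (hit (cell w o)))); last by rewrite l0.
  by apply: le_measure; rewrite ?inE//; [apply: measurableI => //|]; exact: measurable_hit_cell.
rewrite /exponential_prob (_ : _ @^-1` _ = E); last first.
  by apply/seteqP; split => [l [y Ey [<-]]|l El] //=; exists l.
rewrite -!rE -cE /=.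
have r0 : 0 < rate w o by rewrite lt_neqAle hit_rate_ge0 eq_sym -eqe rE l0.
rewrite muleC -ge0_integralZl//; last 3 first.
- by apply/measurable_EFinP; apply: measurable_funTS; exact: measurable_exponential_pdf.
- by move=> l _; rewrite lee_fin exponential_pdf_ge0// ltW.
- by rewrite lee_fin divr_ge0// ?hit_rate_ge0// ltW.
apply: eq_integral => l _; rewrite -EFinM /step_density/= /exponential_pdf patchE indicE.
case: ifPn => _; last by rewrite !mulr0.
by congr EFin; rewrite mulr1; field; rewrite gt_eqF.
Qed.

(** Finiteness is required because the plane of a cell with infinite lifetime is arbitrary. *)
Definition splits_at C w : set Omega := [set o | L w o \is a fin_num /\ C (H w o)].

Lemma measurable_splits_at C w : measurable C -> measurable (splits_at C w).
Proof.
move=> mC; apply: measurableI.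
  by have := emeasurable_fin_num measurableT (measurable_lifetime w); rewrite setTI.
by rewrite -[X in measurable X]setTI; exact: measurable_splitting.
Qed.

Lemma mnw_disintegration w A C (f : \bar R * measurableTypeR R -> \bar R) :
  mnw_past L H (size w) A -> measurable C ->
  measurable_fun setT f -> (forall z, 0 <= f z)%E ->
  (\int[P]_(o in A `&` splits_at C w) f (birth w o, fine (L w o)) =
   \int[P]_(o in A) \int[lebesgue_measure]_(l in `[0%R, +oo[)
      (f (birth w o, l) * (hit_rate C w o * expR (- rate w o * l))%:E))%E.
Proof.
move=> pA mC mf f0; have mA := past_measurable pA.
transitivity (\int[P]_(o in A) \int[lebesgue_measure]_l
    (f (birth w o, l) * (step_density C w (o, l))%:E))%E; last first.
  apply: eq_integral => o _; rewrite [RHS]integral_mkcond; apply: eq_integral => l _.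
  rewrite /step_density/= patchE indicE; case: ifPn => _; first by rewrite mulr1.
  by rewrite !mulr0 mule0.
apply: (@disintegration _ Omega R P _ (\bar R) (birth w) (fun o => fine (L w o)) A
  (A `&` splits_at C w) (step_density C w)) => //.
- exact: measurable_birth.
- by apply: (measurableT_comp (fine_measurable measurableT)); exact: measurable_lifetime.
- by apply: measurableI => //; exact: measurable_splits_at.
- exact: measurable_step_density.
- exact: step_density_ge0.
move=> E1 E2 mE1 mE2.
(* The birth time is known from the past, so a condition on it can be absorbed into the conditioning
   event. *)
have pA1 : mnw_past L H (size w) (A `&` birth w @^-1` E1).
  rewrite mnw_pastE; apply: measurableI => //.
  rewrite -[X in measurable X]setTI; exact: (past_birth (leqnn _)).
rewrite (_ : _ `&` _ = (A `&` birth w @^-1` E1) `&`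
   [set o | (EFin @` E2) (L w o) /\ ((L w o < +oo)%E -> C (H w o))]).
  rewrite mnw_step//; last exact: measurable_image_EFin.
  by apply: eq_integral => o _; rewrite lifetime_split_law.
apply/seteqP; split => o /=.
  move=> [[[Ao [Lo Co]] Eo] E2o]; split => //; split => //.
  by exists (fine (L w o)) => //; rewrite fineK.
move=> [[Ao Eo] [[l E2l lL] Co]]; split; last by rewrite -lL.
by split => //; split => //; split; [rewrite -lL|apply: Co; rewrite -lL ltry].
Qed.

End mnw_cells.

(** * The two weights attached to a birth time *)

Section time_kernels.
Variables (R : realType) (t : R).
Notation TR := (measurableTypeR R).
Notation leb := (@lebesgue_measure R).
Implicit Types (a r s l : R) (u : \bar R).

(** For finite [u <= t], the probability that no plane arrives at rate [a] between [u] and [t]. The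
    indicator also gives 0 at [+oo], where [fine] would return 0. *)
Definition survival a u : R :=
  \1_[set u | (u <= t%:E)%E] u * expR (- ((t - fine u) * a)).

(** The weight exp (- u), made 0 at [+oo]; without the cut-off at [t] its integral over a lifetime
    is an explicit multiple of itself. *)
Definition discount u : R := \1_[set u | (u < +oo)%E] u * expR (- fine u).

Lemma survival_ge0 a u : 0 <= survival a u.
Proof. by rewrite mulr_ge0// expR_ge0. Qed.

Lemma discount_ge0 u : 0 <= discount u.
Proof. by rewrite mulr_ge0// expR_ge0. Qed.

Lemma measurable_survival a : measurable_fun setT (survival a).
Proof.
apply: measurable_funM.
  apply: measurable_indic; rewrite (_ : [set _ | _] = `]-oo, t%:E]%classic).
    exact: emeasurable_itv.
  by apply/seteqP; split => u /=; rewrite in_itv.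
apply: measurableT_comp => //; apply: measurableT_comp => //.
by apply: measurable_funM => //; exact: measurable_funB.
Qed.

Lemma measurable_discount : measurable_fun setT discount.
Proof.
apply: measurable_funM.
  apply: measurable_indic; rewrite (_ : [set _ | _] = `]-oo, +oo%E[%classic).
    exact: emeasurable_itv.
  by apply/seteqP; split => u /=; rewrite in_itv.
by apply: measurableT_comp => //; exact: measurableT_comp.
Qed.

Lemma survivalE a r : survival a r%:E = if r <= t then expR (- ((t - r) * a)) else 0.
Proof.
rewrite /survival indicE; case: ifPn => rt.
  by rewrite mem_set ?mul1r//= lee_fin.
by rewrite memNset ?mul0r//= lee_fin; exact/negP.
Qed.

Lemma survivaly a : survival a +oo%E = 0.
Proof. by rewrite /survival indicE memNset ?mul0r//= leNgt ltry. Qed.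

Lemma discountE r : discount r%:E = expR (- r).
Proof. by rewrite /discount indicE mem_set ?mul1r//= ltry. Qed.

Lemma discounty : discount +oo%E = 0.
Proof. by rewrite /discount indicE memNset ?mul0r//= ltxx. Qed.

Lemma survival_le a u : (0 <= u)%E -> 0 <= a -> survival a u <= expR t * discount u.
Proof.
case: u => [r||//] u0 a0; last by rewrite survivaly discounty mulr0.
rewrite survivalE discountE -expRD; case: ifPn => [rt|_]; last exact: expR_ge0.
apply: (@le_trans _ _ 1).
  by rewrite -[leRHS]expR0 ler_expR oppr_le0 mulr_ge0// subr_ge0.
by rewrite -[leLHS]expR0 ler_expR subr_ge0.
Qed.

(** The renewal identity behind the recursion. After factoring out exp (- (t - s) a), the integrand
    is the exponential density of rate [r - a], integrated over the remaining time. *)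
Lemma integral_survival a r u : (0 <= u)%E -> 0 <= a <= r ->
  (\int[leb]_(l in `[0%R, +oo[) ((survival a (u + l%:E))%:E * ((r - a) * expR (- r * l))%:E) =
   (survival a u - survival r u)%:E)%E.
Proof.
move=> u0 /andP[a0 ar]; case: u u0 => [s||//] s0; last first.
  rewrite !survivaly subrr; apply: integral0_eq => l _.
  by rewrite mul0e.
rewrite !survivalE; have [st|ts] := leP s t; last first.
  rewrite subrr; apply: integral0_eq => l; rewrite /= in_itv/= andbT => l0.
  by rewrite -EFinD survivalE ifF ?mul0e//; apply/negbTE; rewrite -ltNge; lra.
have r0 : 0 <= r - a by lra.
have ts0 : 0 <= t - s by lra.
transitivity (\int[leb]_(l in `[0%R, (t - s)%R])
    ((expR (- ((t - s) * a)))%:E * ((r - a) * expR (- (r - a) * l))%:E))%E.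
  rewrite [LHS]integral_mkcond [RHS]integral_mkcond; apply: eq_integral => l _.
  rewrite !patchE !mem_setE !in_itv/= andbT.
  case: ifPn => l0 //=; rewrite -EFinD survivalE lerBrDl.
  case: ifPn => _; last by rewrite mul0e.
  rewrite -!EFinM mulrCA [in RHS]mulrCA -!expRD; congr ((_ * expR _)%:E).
  by ring.
rewrite ge0_integralZl//; last 2 first.
- apply/measurable_EFinP; apply: measurable_funTS.
  by apply: measurable_funM => //; apply: measurableT_comp.
- by move=> l _; rewrite lee_fin mulr_ge0// expR_ge0.
rewrite integral_expR_itv0c// -EFinM mulrBr mulr1 -expRD; congr ((_ - expR _)%:E).
by ring.
Qed.

(** The factor exp (- l) raises the rate to [r + 1], while the prefactor remains [r - a]; the
    quotient is the contraction factor. *)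
Lemma integral_discount a r u : (0 <= u)%E -> 0 <= a <= r ->
  (\int[leb]_(l in `[0%R, +oo[) ((discount (u + l%:E))%:E * ((r - a) * expR (- r * l))%:E) =
   (discount u * ((r - a) / (r + 1)))%:E)%E.
Proof.
move=> u0 /andP[a0 ar]; case: u u0 => [s||//] s0; last first.
  rewrite discounty mul0r; apply: integral0_eq => l _.
  by rewrite mul0e.
have r1 : 0 < r + 1 by lra.
rewrite discountE.
transitivity (\int[leb]_(l in `[0%R, +oo[)
    ((expR (- s) * ((r - a) / (r + 1)))%:E * ((r + 1) * expR (- (r + 1) * l))%:E))%E.
  apply: eq_integral => l _; rewrite -EFinD discountE -!EFinM; congr (_%:E).
  rewrite (_ : - (r + 1) * l = - l + - r * l); last by ring.
  rewrite opprD !expRD; field; exact: lt0r_neq0.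
rewrite ge0_integralZl//; last 3 first.
- apply/measurable_EFinP; apply: measurable_funTS.
  by apply: measurable_funM => //; apply: measurableT_comp.
- by move=> l _; rewrite lee_fin mulr_ge0 ?expR_ge0// ltW.
- by rewrite lee_fin mulr_ge0 ?expR_ge0// divr_ge0//; lra.
by rewrite integral_expR_itv0y// mule1.
Qed.

End time_kernels.

(** * Words of a given length *)

Fixpoint words (n : nat) : seq (seq bool) :=
  if n is n'.+1 then [seq true :: w | w <- words n'] ++ [seq false :: w | w <- words n']
  else [:: [::]].

Lemma mem_words n w : (w \in words n) = (size w == n).
Proof.
elim: n w => [|n IHn] w /=; first by rewrite inE size_eq0.
rewrite mem_cat; case: w => [|b w]; first by apply/orP => -[] /mapP[].
rewrite /= eqSS -IHn; case: b.
  rewrite mem_map => [|? ? []//]; rewrite orbC.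
  by case: mapP => // -[].
rewrite orbC mem_map => [|? ? []//]; rewrite orbC.
by case: mapP => // -[].
Qed.

Lemma uniq_words n : uniq (words n).
Proof.
elim: n => //= n IHn; rewrite cat_uniq !map_inj_uniq ?IHn => [|? ? []//|? ? []//].
by rewrite /= andbT; apply/hasPn => _ /mapP[w _ ->]; apply/negP => /mapP[].
Qed.

(** Groups a sum over one generation into pairs of siblings, as the recursions need. *)
Lemma big_words (R : Type) (idx : R) (op : Monoid.com_law idx) n (F : seq bool -> R) :
  \big[op/idx]_(w <- words n.+1) F w =
  \big[op/idx]_(w <- words n) op (F (true :: w)) (F (false :: w)).
Proof. by rewrite /= big_cat !big_map big_split. Qed.

(** * The recursion over generations *)

Section mnw_recursion.
Variables (R : realType) (d : nat).
Notation V := 'rV[R]_d.+1.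
Variables (W : set V) (x : nat -> V).
Hypotheses (W_compact : compact W) (cW : segconvex W).
Hypothesis xW : forall i, W (x i).
Hypothesis xd : forall G, open G -> W `&` G !=set0 -> exists i, G (x i).
Variable Lambda : {measure set (hyp R d) -> \bar R}.
Hypothesis Lambda_lf : locally_finite_hyp Lambda.
Variables (dO : measure_display) (Omega : measurableType dO).
Variable P : probability Omega R.
Variables (L : seq bool -> Omega -> \bar R) (H : seq bool -> Omega -> hyp R d).
Hypothesis LH_mnw : is_mnw Lambda W P L H.
Variable t : R.
Implicit Types (w v : seq bool) (o : Omega).

Local Notation ocell := (mnw_open_cell W H).
Local Notation cell := (mnw_cell W H).
Local Notation birth := (birth_time L).
Local Notation rate := (hit_rate W Lambda H setT).

(* Nonnegativity of the lifetimes only holds almost surely: it is made part of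
   this event so that birth times increase along the ancestors of [w]. *)
Fixpoint lineage (Z : set V) w o : Prop :=
  if w is b :: w' then
    [/\ lineage Z w' o, (0 <= L w' o)%E & forall z, Z z -> side b (H w' o) z]
  else True.

Lemma lineage_birth Z w o : lineage Z w o -> (0 <= birth w o)%E.
Proof.
by elim: w => [|b w IHw] //= [/IHw w0 L0 _]; exact: adde_ge0.
Qed.

Lemma lineage_open_cell Z w o : Z `<=` W -> lineage Z w o -> Z `<=` ocell w o.
Proof.
by move=> ZW; elim: w => [|b w IHw] //= [/IHw w0 _ sZ] z Zz; split; [exact: w0|exact: sZ].
Qed.

Lemma open_cell_lineage Z w o : (forall v, 0 <= L v o)%E -> Z `<=` ocell w o -> lineage Z w o.
Proof.
move=> L0; elim: w => [|b w IHw] //= Zw; split => //; last by move=> z /Zw[].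
by apply: IHw => z /Zw[].
Qed.

(** Two distinct words of equal length have ancestors that are siblings, on opposite sides of one
    plane; [Z] cannot lie on both. *)
Lemma lineage_uniq Z w v o : Z !=set0 -> size w = size v ->
  lineage Z w o -> lineage Z v o -> w = v.
Proof.
move=> [z Zz]; elim: w v => [|b w IHw] [|c v] //= [wv] [lw _ sw] [lv _ sv].
have e := IHw v wv lw lv; rewrite -e in sv *; congr (_ :: _).
apply/eqP/negPn/negP => bc; have := side_disj (sw _ Zz); apply.
by rewrite (_ : ~~ b = c); [exact: sv|case: b c bc {sw sv} => -[]].
Qed.

(** By [lineage_uniq] the ancestor of [v] in the generation of [w] is [w] itself, so [v] is not born
    before [w] dies. *)
Lemma lineage_birth_le Z w v o : Z !=set0 -> (size w < size v)%N ->
  lineage Z w o -> lineage Z v o -> (birth w o + L w o <= birth v o)%E.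
Proof.
move=> Z0 + lw; elim: v => [|c v IHv] //=.
rewrite ltnS leq_eqVlt => /orP[/eqP wv|wv] [lv L0 _].
  by rewrite (lineage_uniq Z0 wv lw lv).
by apply: (le_trans (IHv wv lv)); rewrite leeDl.
Qed.

Definition alive w o := (birth w o <= t%:E)%E /\ (t%:E < birth w o + L w o)%E.

(** The words whose cells contain [Z] form one line of descent, with life intervals that are closed
    on the left, open on the right and do not overlap. *)
Lemma alive_uniq Z w v o : Z !=set0 -> lineage Z w o -> lineage Z v o ->
  alive w o -> alive v o -> w = v.
Proof.
move=> Z0 lw lv [bw tw] [bv tv]; have [wv|vw|wv] := ltngtP (size w) (size v).
- have := lineage_birth_le Z0 wv lw lv => /(lt_le_trans tw).
  by rewrite ltNge bv.
- have := lineage_birth_le Z0 vw lv lw => /(lt_le_trans tv).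
  by rewrite ltNge bw.
- exact: lineage_uniq wv lw lv.
Qed.

Variables (i : nat) (J : seq nat).
(** Here [Z] is the finite set of points that span the star, not the star; [avoidE] and [star_cell]
    pass between the two by convexity. *)
Let Z : set V := x @` [set j | j \in i :: J].
Let T : set (hyp R d) := ~` hit (star x i J).
Let a : R := fine (Lambda (hit (star x i J))).

Let mT : measurable T.
Proof. by apply: measurableC; exact: measurable_hit_star. Qed.

Let ZW : Z `<=` W. Proof. by move=> _ [j _ <-]. Qed.

Let Z0 : Z !=set0. Proof. by exists (x i), i => //=; exact: mem_head. Qed.

Let avoid b : set (hyp R d) := [set h | forall z, Z z -> side b h z].

Let measurable_avoid b : measurable (avoid b).
Proof.
rewrite (_ : avoid b = \bigcap_(j in [set j | j \in i :: J]) [set h | side b h (x j)]).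
  by apply: bigcap_measurableType => j _; exact: measurable_side.
by apply/seteqP; split => h hz; [move=> j jJ; apply: hz; exists j|move=> _ [j jJ <-]; exact: hz].
Qed.

(** All segments start at [x i], so a plane missing the star leaves every point on the side of
    [x i]. Conversely a side is convex. *)
Let avoidE : T = avoid true `|` avoid false.
Proof.
apply/seteqP; split => h.
  move=> nh; have segh j : j \in i :: J -> seg (x i) (x j) `&` points h = set0.
    move=> jJ; rewrite -subset0 => z [jz hz]; apply: nh; exists z; split => //.
    by exists j.
  have ih : ~ points h (x i).
    move=> ih; have : (seg (x i) (x i) `&` points h) (x i).
      by split => //; exact: seg_start.
    by rewrite segh// mem_head.
  by have [si|si] := side_cover ih; [left|right] => _ [j jJ <-];
    apply: seg_same_side si _; exact: segh.
suff sH b : avoid b h -> T h by move=> [|]; exact: sH.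
move=> ah [z [hz [j jJ jz]]].
have zi : Z (x i) by exists i => //=; exact: mem_head.
have zj : Z (x j) by exists j.
exact: (side_points (side_seg (ah _ zi) (ah _ zj) jz)).
Qed.

Let avoid_disj : [disjoint avoid true & avoid false].
Proof.
apply/disj_setPS => h [ht hf]; have [z Zz] := Z0.
exact: (@side_disj _ _ true h z (ht z Zz) (hf z Zz)).
Qed.

Let good w : set Omega := [set o | lineage Z w o].

Let good_cons b w : good (b :: w) =
  good w `&` [set o | (0 <= L w o)%E] `&` H w @^-1` avoid b.
Proof. by apply/seteqP; split => o; [move=> []|move=> [[]]]. Qed.

Let past_good w n : (size w <= n)%N -> mnw_past L H n (good w).
Proof.
rewrite mnw_pastE; elim: w => [|b w IHw] wn.
  by rewrite [X in measurable X](_ : _ = setT); [exact: measurableT|apply/seteqP; split].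
rewrite good_cons; apply: measurableI; first apply: measurableI.
- by apply: IHw; exact: ltnW.
- rewrite -[X in measurable X]setTI.
  apply: emeasurable_fun_c_infty => //.
  exact: past_lifetime.
- by rewrite -[X in measurable X]setTI; exact: (past_splitting wn).
Qed.

Let measurable_good w : measurable (good w).
Proof. exact: (past_measurable LH_mnw (past_good (leqnn _))). Qed.

Let star_cell w o : good w o -> star x i J `<=` cell w o.
Proof.
move=> gw z [j jJ jz]; rewrite mnw_cellE//; apply: subset_closure.
have oZ := lineage_open_cell ZW gw.
apply: (is_open_cell_seg cW (is_open_cell_mnw W H w o)) jz.
- by apply: oZ; exists i => //=; exact: mem_head.
- by apply: oZ; exists j.
Qed.

(** The star lies in the cell, so the planes hitting it are among those hitting the cell, and the
    finite measures subtract. *)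
Let hit_rate_avoid w o : good w o -> hit_rate W Lambda H T w o = rate w o - a.
Proof.
move=> gw; have mst := measurable_hit_star x i J.
have mce := measurable_hit_cell W_compact H w o.
have sc := @hitS _ _ _ _ (star_cell gw).
apply: EFin_inj; rewrite hit_rateE// EFinB hit_rateE//.
have stfin : Lambda (hit (star x i J)) \is a fin_num.
  by rewrite ge0_fin_numE//; apply: (hit_lty W_compact) => //; exact: star_sub.
rewrite /a fineK// setTI setIC -setDE measureD//; last exact: hit_cell_lty.
by rewrite setIidr.
Qed.

Let a_ge0 : 0 <= a. Proof. exact: fine_ge0. Qed.

Let a_le_rate w o : good w o -> a <= rate w o.
Proof. by move=> gw; rewrite -subr_ge0 -hit_rate_avoid// hit_rate_ge0. Qed.

Let null_lifetime w : P [set o | (L w o < 0)%E] = 0%E.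
Proof. exact: lifetime_ge0 LH_mnw w. Qed.

Let measurable_null_lifetime w : measurable [set o | (L w o < 0)%E].
Proof.
rewrite -[X in measurable X]setTI; apply: emeasurable_fun_infty_o => //.
exact: (measurable_lifetime LH_mnw).
Qed.

Local Notation splits C w := (splits_at L H C w).

Let mL w : measurable_fun setT (L w). Proof. exact: (measurable_lifetime LH_mnw). Qed.
Let mbirth w : measurable_fun setT (birth w). Proof. exact: (measurable_birth LH_mnw). Qed.

Let measurable_next (F : \bar R -> R) w : measurable_fun setT F ->
  measurable_fun setT (fun o => (F (birth w o + (fine (L w o))%:E))%:E : \bar R)%E.
Proof.
move=> mF; apply/measurable_EFinP; apply: measurableT_comp => //.
apply: emeasurable_funD => //; apply/measurable_EFinP.
exact: (measurableT_comp (fine_measurable measurableT)).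
Qed.

(** A finite lifetime followed by a plane missing the star puts [Z] into exactly one child. If the
    lifetime is infinite the child is born at [+oo], where [F] vanishes; negative lifetimes form a
    null event. *)
Let children (F : \bar R -> R) w : measurable_fun setT F -> (forall u, 0 <= F u) ->
  F +oo%E = 0 ->
  (\int[P]_(o in good (true :: w)) (F (birth (true :: w) o))%:E +
   \int[P]_(o in good (false :: w)) (F (birth (false :: w) o))%:E =
   \int[P]_(o in good w `&` splits T w) (F (birth w o + (fine (L w o))%:E))%:E)%E.
Proof.
move=> mF F0 Foo; have mFL := measurable_next w mF.
pose D b := good w `&` [set o | (0 <= L w o)%E] `&` splits (avoid b) w.
have mS C : measurable C -> measurable (splits C w) by exact: (measurable_splits_at LH_mnw).
have mL0 : measurable [set o | (0 <= L w o)%E].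
  by rewrite -[X in measurable X]setTI; exact: emeasurable_fun_c_infty.
have mD b : measurable (D b).
  by apply: measurableI; [exact: measurableI|exact: mS].
have goodD b : (\int[P]_(o in good (b :: w)) (F (birth (b :: w) o))%:E =
    \int[P]_(o in D b) (F (birth w o + (fine (L w o))%:E))%:E)%E.
  rewrite integral_mkcond [RHS]integral_mkcond; apply: eq_integral => o _.
  rewrite !patchE good_cons; have [/set_mem[[gw Lw] [Lfin Hw]]|ob] := boolP (o \in D b).
    by rewrite mem_set//= fineK.
  case: ifPn => // /set_mem[[gw Lw] Hw].
  have Ly : L w o = +oo%E.
    apply/eqP; apply: contraNT ob => Ly; apply/mem_set; split => //; split => //.
    by rewrite ge0_fin_numE// ltey.
  by rewrite /= Ly addey ?Foo// gt_eqF// (lt_le_trans _ (lineage_birth gw))// ltNyr.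
rewrite !goodD -ge0_integral_setU//; last 3 first.
- exact/measurable_funTS.
- by move=> o _; rewrite lee_fin.
- apply/disj_setPS => o [[_ [_ ht]] [_ [_ hf]]].
  by have /disj_setPS/(_ _ (conj ht hf)) := avoid_disj.
have mgs : measurable (good w `&` splits T w) by apply: measurableI => //; exact: mS.
rewrite [RHS](ge0_negligible_integral (measurable_null_lifetime w))//; last 3 first.
- exact/measurable_funTS.
- by move=> o _; rewrite lee_fin.
- exact: null_lifetime.
congr (integral P _ _); apply/seteqP; split => o.
  move=> Do; have [b [[gw Lw] [Lf Hw]]] : exists b, D b o.
    by case: Do; [exists true|exists false].
  split; last by rewrite /= ltNge Lw.
  by split => //; split => //; rewrite avoidE; case: b Hw => Hw; [left|right].
move=> [[gw [Lf]]]; rewrite avoidE => Hw /negP; rewrite -leNgt => Lw.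
by case: Hw => Hw; [left|right].
Qed.

Let next_integral (F : \bar R -> R) C w : measurable C ->
  measurable_fun setT F -> (forall u, 0 <= F u) ->
  (\int[P]_(o in good w `&` splits C w) (F (birth w o + (fine (L w o))%:E))%:E =
   \int[P]_(o in good w) \int[lebesgue_measure]_(l in `[0%R, +oo[)
     ((F (birth w o + l%:E))%:E *
      (hit_rate W Lambda H C w o * expR (- rate w o * l))%:E))%E.
Proof.
move=> mC mF F0.
apply: (mnw_disintegration W_compact xW xd Lambda_lf LH_mnw
  (f := fun z => (F (z.1 + z.2%:E)%E)%:E)) => //.
- exact: past_good.
- apply/measurable_EFinP; apply: measurableT_comp => //.
  by apply: emeasurable_funD => //; exact/measurable_EFinP.
- by move=> z; rewrite lee_fin.
Qed.

(** Used for [C = T] with [b = a] in the recursion, and for [C = setT] with [b = 0] in the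
    computation of [P (live w)]. *)
Let integral_survival_next C b w : measurable C -> 0 <= b ->
  (forall o, good w o -> hit_rate W Lambda H C w o = rate w o - b) ->
  (\int[P]_(o in good w `&` splits C w) (survival t b (birth w o + (fine (L w o))%:E))%:E =
   \int[P]_(o in good w) (survival t b (birth w o) - survival t (rate w o) (birth w o))%:E)%E.
Proof.
move=> mC b0 hb; rewrite next_integral//; last 2 first.
- exact: measurable_survival.
- exact: survival_ge0.
apply: eq_integral => o /set_mem gw; rewrite hb//.
rewrite integral_survival ?(lineage_birth gw)// b0/= -subr_ge0 -hb//.
exact: hit_rate_ge0.
Qed.

Let measurable_survival_birth b w :
  measurable_fun setT (fun o => survival t b (birth w o)).
Proof. by apply: measurableT_comp => //; exact: measurable_survival. Qed.

Let measurable_survival_rate w :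
  measurable_fun setT (fun o => survival t (rate w o) (birth w o)).
Proof.
have m1 : measurable_fun setT (\1_[set u : \bar R | (u <= t%:E)%E] : \bar R -> R).
  apply: measurable_indic; rewrite (_ : [set _ | _] = `]-oo, t%:E]%classic).
    exact: emeasurable_itv.
  by apply/seteqP; split => u /=; rewrite in_itv.
rewrite /survival; apply: measurable_funM; first exact: (measurableT_comp m1 (mbirth w)).
apply: measurableT_comp => //; apply: measurableT_comp => //.
apply: measurable_funM; last exact: (measurable_hit_rate W_compact xW xd Lambda_lf LH_mnw).
apply: measurable_funB => //.
exact: (measurableT_comp (fine_measurable measurableT)).
Qed.

Let survival_mono b r u : (0 <= u)%E -> b <= r -> survival t r u <= survival t b u.
Proof.
case: u => [s||//] s0 br; last by rewrite !survivaly.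
rewrite !survivalE; case: ifPn => // st.
by rewrite ler_expR lerN2 ler_wpM2l// subr_ge0.
Qed.

(* Over the words [w] of length [n], [hval w] sums to h_n and [ends w] to p_n;
   [gval w] dominates [hval w] up to a constant, and its sum over the two children
   of [w] is at most [rho] times [gval w]. *)
Let hval w := (\int[P]_(o in good w) (survival t a (birth w o))%:E)%E.
Let ends w := (\int[P]_(o in good w) (survival t (rate w o) (birth w o))%:E)%E.
Let gval w := (\int[P]_(o in good w) (discount (birth w o))%:E)%E.

Let integral_survival_split b w :
  (forall o, good w o -> b <= rate w o) ->
  (\int[P]_(o in good w) (survival t b (birth w o))%:E =
   ends w + \int[P]_(o in good w)
     (survival t b (birth w o) - survival t (rate w o) (birth w o))%:E)%E.
Proof.
move=> br; rewrite -ge0_integralD//.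
- by apply: eq_integral => o _; rewrite -EFinD addrC subrK.
- by move=> o _; rewrite lee_fin survival_ge0.
- exact/measurable_funTS/measurable_EFinP.
- move=> o gw; rewrite lee_fin subr_ge0; apply: survival_mono (br _ gw).
  exact: lineage_birth gw.
- by apply/measurable_funTS/measurable_EFinP; exact: measurable_funB.
Qed.

Let hval_rec w : hval w = (ends w + (hval (true :: w) + hval (false :: w)))%E.
Proof.
rewrite /hval children; last 3 first.
- exact: measurable_survival.
- exact: survival_ge0.
- exact: survivaly.
rewrite (integral_survival_next mT a_ge0); last exact: hit_rate_avoid.
by apply: integral_survival_split => o; exact: a_le_rate.
Qed.

Definition live w : set Omega := [set o | [/\ lineage Z w o, (0 <= L w o)%E & alive w o]].

Let measurable_alive w : measurable [set o | alive w o].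
Proof.
apply: measurableI.
  rewrite -[X in measurable X]setTI; exact: emeasurable_fun_infty_c.
rewrite -[X in measurable X]setTI; apply: emeasurable_fun_o_infty => //.
exact: emeasurable_funD.
Qed.

Lemma measurable_live w : measurable (live w).
Proof.
rewrite (_ : live w = good w `&` [set o | (0 <= L w o)%E] `&` [set o | alive w o]).
  apply: measurableI => //; apply: measurableI => //.
  by rewrite -[X in measurable X]setTI; exact: emeasurable_fun_c_infty.
by apply/seteqP; split => o; [move=> []|move=> [[]]].
Qed.

Let survival0 u : survival t 0 u = \1_[set u | (u <= t%:E)%E] u.
Proof. by rewrite /survival mulr0 oppr0 expR0 mulr1. Qed.

(** For [b = 0] the kernel [survival] is the indicator of times up to [t]. The mass of births by [t]
    therefore exceeds the mass of deaths by [t] by [ends w]; it also exceeds it by the mass of being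
    alive at [t]. *)
Let P_live w : P (live w) = ends w.
Proof.
have mle (f : Omega -> \bar R) : measurable_fun setT f ->
    measurable [set o | (f o <= t%:E)%E].
  by move=> mf; rewrite -[X in measurable X]setTI; exact: emeasurable_fun_infty_c.
have mnext : measurable_fun setT (fun o => birth w o + (fine (L w o))%:E)%E.
  apply: emeasurable_funD => //; apply/measurable_EFinP.
  exact: (measurableT_comp (fine_measurable measurableT)).
have mS : measurable (splits setT w) by exact: (measurable_splits_at LH_mnw).
pose A1 := good w `&` [set o | (birth w o <= t%:E)%E].
pose B1 := good w `&` splits setT w `&` [set o | (birth w o + (fine (L w o))%:E <= t%:E)%E].
have mA1 : measurable A1 by apply: measurableI => //; exact: mle.
have mB1 : measurable B1.
  by apply: measurableI; [exact: measurableI|exact: mle].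
have PA1 : (P A1 = ends w + P B1)%E.
  transitivity (\int[P]_(o in good w) (survival t 0 (birth w o))%:E)%E.
    transitivity (\int[P]_(o in good w) (\1_[set o | (birth w o <= t%:E)%E] o)%:E)%E.
      by rewrite integral_indic//; [rewrite setIC|exact: mle].
    by apply: eq_integral => o _; rewrite survival0.
  rewrite (integral_survival_split (b := 0)); last first.
    by move=> o _; exact: hit_rate_ge0.
  congr (_ + _)%E; rewrite -(integral_survival_next (C := setT))//; last first.
    by move=> o _; rewrite subr0.
  transitivity (\int[P]_(o in good w `&` splits setT w)
      (\1_[set o | (birth w o + (fine (L w o))%:E <= t%:E)%E] o)%:E)%E.
    by apply: eq_integral => o _; rewrite survival0.
  by rewrite integral_indic//; [rewrite setIC|exact: measurableI|exact: mle].
(* Off the null event of a negative lifetime, the cells born by [t] are those alive at [t] and those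
   dead by [t]. *)
have PA1' : (P A1 = P (live w) + P B1)%E.
  pose N := [set o | (L w o < 0)%E].
  have mN : measurable N by exact: measurable_null_lifetime.
  have negl A : measurable A -> P A = P (A `\` N).
    move=> mA; rewrite (measureDI P mA mN) [X in (_ + X)%E](_ : _ = 0%E) ?adde0//.
    apply/eqP; rewrite -measure_le0 -(null_lifetime w).
    by apply: le_measure; rewrite ?inE//; exact: measurableI.
  have mB1N : measurable (B1 `\` N) by exact: measurableD.
  rewrite negl// [P B1]negl// -measureU//; last 2 first.
  - exact: measurable_live.
  - rewrite -subset0 => o [[_ _ [_ tL]] [[[_ [Lf _]] Lt] _]].
    by move: tL Lt; rewrite /= fineK// ltNge => /negP.
  congr (P _); apply/seteqP; split => o.
    move=> [[gw bt] /negP]; rewrite -leNgt => L0.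
    have [Lb|tL] := leP (birth w o + L w o)%E (t%:E)%E; [right|left => //].
    have Lf : L w o \is a fin_num.
      rewrite ge0_fin_numE// ltey; apply: contraTneq Lb => ->.
      by rewrite addey ?leye_eq// gt_eqF// (lt_le_trans _ (lineage_birth gw))// ltNyr.
    by split; [split; [split|rewrite /= fineK]|apply/negP; rewrite -leNgt].
  move=> [[gw L0 [bt _]]|[[[gw [Lf _]] Lt] /negP]].
    by split; [split|apply/negP; rewrite -leNgt].
  rewrite -leNgt => L0; split; last by apply/negP; rewrite -leNgt.
  split => //; apply: le_trans Lt; rewrite leeDl// lee_fin fine_ge0//.
have B1fin : P B1 \is a fin_num.
  by rewrite ge0_fin_numE// (le_lt_trans (probability_le1 P mB1))// ltry.
have := congr1 (fun u => (u - P B1)%E) PA1'.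
by rewrite PA1 /= !addeK.
Qed.

(** The quotient [(r - a) / (r + 1)] is at most [r / (r + 1)], which increases with [r], and no cell
    has a rate above that of [W]. *)
Let rho : R := let b := fine (Lambda (hit W)) in b / (b + 1).

Let rho_ge0 : 0 <= rho.
Proof. by rewrite divr_ge0 ?addr_ge0 ?fine_ge0. Qed.

Let rho_lt1 : rho < 1.
Proof.
have b0 : 0 <= fine (Lambda (hit W)) by rewrite fine_ge0.
by rewrite /rho ltr_pdivrMr ?mul1r ?ltrDl// ltr_wpDl.
Qed.

Let rate_rho w o : (rate w o - a) / (rate w o + 1) <= rho.
Proof.
have b0 : 0 <= fine (Lambda (hit W)) by rewrite fine_ge0.
have r0 : 0 <= rate w o by exact: hit_rate_ge0.
have rb : rate w o <= fine (Lambda (hit W)).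
  have mW := @measurable_hit_compact R d _ W_compact.
  rewrite /hit_rate setTI fine_le ?ge0_fin_numE//.
  - exact: hit_cell_lty.
  - exact: (hit_lty W_compact).
  - apply: le_measure; rewrite ?inE//; first exact: measurable_hit_cell.
    by apply: hitS; exact: mnw_cell_sub.
rewrite /rho ler_pdivrMr ?ltr_wpDl// mulrAC ler_pdivlMr ?ltr_wpDl//.
by have := a_ge0; nra.
Qed.

Let gval_rec w : (gval (true :: w) + gval (false :: w) <= rho%:E * gval w)%E.
Proof.
rewrite /gval children; last 3 first.
- exact: measurable_discount.
- exact: discount_ge0.
- exact: discounty.
have mdb : measurable_fun setT (fun o => discount (birth w o)).
  by apply: measurableT_comp => //; exact: measurable_discount.
rewrite next_integral//; last 2 first.
- exact: measurable_discount.
- exact: discount_ge0.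
rewrite -ge0_integralZl//; last 2 first.
- exact/measurable_funTS/measurable_EFinP.
- by move=> o _; rewrite lee_fin discount_ge0.
have mr : measurable_fun setT (fun o => (discount (birth w o) * ((rate w o - a) / (rate w o + 1)))%:E).
  apply/measurable_EFinP; apply: measurable_funM => //.
  have mrate : measurable_fun setT (rate w) by exact: (measurable_hit_rate W_compact xW xd Lambda_lf LH_mnw).
  apply: measurable_funM; first exact: measurable_funB.
  rewrite (_ : (fun o => (rate w o + 1)^-1) = (fun y => y `^ (-1)) \o (fun o => rate w o + 1)).
    by apply: measurableT_comp; [exact: measurable_powR|exact: measurable_funD].
  by apply/funext => o /=; rewrite powR_inv1// addr_ge0 ?hit_rate_ge0.
apply: (@le_trans _ _ (\int[P]_(o in good w)
    (discount (birth w o) * ((rate w o - a) / (rate w o + 1)))%:E)%E).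
  rewrite le_eqVlt; apply/orP; left; apply/eqP; apply: eq_integral => o /set_mem gw.
  rewrite hit_rate_avoid// integral_discount ?(lineage_birth gw)//.
  by rewrite a_ge0/=; exact: a_le_rate.
apply: ge0_le_integral => //.
- move=> o gw; rewrite lee_fin mulr_ge0 ?discount_ge0//.
  by rewrite divr_ge0 ?subr_ge0 ?a_le_rate// addr_ge0 ?hit_rate_ge0.
- exact: measurable_funTS.
- by apply: measurable_funTS; apply/measurable_EFinP; exact: measurable_funM.
- by move=> o gw; rewrite lee_fin mulrC ler_wpM2r ?discount_ge0.
Qed.

Let gval_ge0 w : (0 <= gval w)%E.
Proof. by apply: integral_ge0 => o _; rewrite lee_fin discount_ge0. Qed.

Let hval_ge0 w : (0 <= hval w)%E.
Proof. by apply: integral_ge0 => o _; rewrite lee_fin survival_ge0. Qed.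

Let sum_gval n : (\sum_(w <- words n) gval w <= (rho ^+ n)%:E)%E.
Proof.
elim: n => [|n IHn].
  rewrite big_seq1 expr0 /gval (_ : good [::] = setT); last by apply/seteqP; split.
  under eq_integral do rewrite /= discountE oppr0 expR0.
  by rewrite integral_cst// mul1e; exact: probability_le1.
rewrite big_words; apply: (@le_trans _ _ (rho%:E * \sum_(w <- words n) gval w)%E).
  rewrite ge0_sume_distrr; last by move=> w _; exact: gval_ge0.
  by apply: lee_sum => w _; exact: gval_rec.
by rewrite exprS (EFinM rho (rho ^+ n)) lee_wpmul2l ?lee_fin.
Qed.

Let sum_hval_le n : (\sum_(w <- words n) hval w <= (expR t * rho ^+ n)%:E)%E.
Proof.
have mdb w : measurable_fun setT (fun o => discount (birth w o)).
  by apply: measurableT_comp => //; exact: measurable_discount.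
apply: (@le_trans _ _ ((expR t)%:E * \sum_(w <- words n) gval w)%E); last first.
  by rewrite (EFinM (expR t)) lee_wpmul2l ?lee_fin ?expR_ge0.
rewrite ge0_sume_distrr; last by move=> w _; exact: gval_ge0.
apply: lee_sum => w _; rewrite -ge0_integralZl//; last 2 first.
- exact/measurable_funTS/measurable_EFinP.
- by move=> o _; rewrite lee_fin discount_ge0.
apply: ge0_le_integral => //.
- by move=> o _; rewrite lee_fin survival_ge0.
- by apply: measurable_funTS; apply/measurable_EFinP.
- by apply: measurable_funTS; apply/measurable_EFinP; exact: measurable_funM.
- by move=> o gw; rewrite lee_fin survival_le//; exact: lineage_birth gw.
Qed.

Hypothesis t0 : 0 <= t.

Let hval_root : hval [::] = (expR (- (t * a)))%:E.
Proof.
rewrite /hval (_ : good [::] = setT); last by apply/seteqP; split.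
under eq_integral do rewrite /= survivalE t0 subr0.
rewrite integral_cst// -[RHS]mule1; congr (_ * _)%E; exact: probability_setT.
Qed.

(** The recursion telescoped: the remainder after [n] generations is the sum of [hval] over the
    words of length [n]. *)
Let partial_sum n :
  (\sum_(0 <= k < n) \sum_(w <- words k) P (live w) + \sum_(w <- words n) hval w =
   (expR (- (t * a)))%:E)%E.
Proof.
elim: n => [|n IHn]; first by rewrite big_geq// add0e big_seq1 hval_root.
rewrite big_nat_recr//= -IHn -addeA; congr (_ + _)%E.
rewrite big_words -big_split/=; apply: eq_bigr => w _.
by rewrite P_live [RHS]hval_rec.
Qed.

Lemma live_disj : trivIset setT live.
Proof.
apply/trivIsetP => w v _ _ wv; rewrite -subset0 => o [[lw _ aw] [lv _ av]].
by move/eqP: wv; apply; exact: alive_uniq lw lv aw av.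
Qed.

Lemma P_live_union : P (\bigcup_w live w) = (expR (- (t * a)))%:E.
Proof.
pose F n := \bigcup_(w in [set` words n]) live w.
have mF n : measurable (F n).
  by apply: fin_bigcup_measurable => [|w _]; [exact: finite_seq|exact: measurable_live].
have PF n : P (F n) = (\sum_(w <- words n) P (live w))%E.
  rewrite measure_fin_bigcup//.
  - by rewrite -fsbig_seq// uniq_words.
  - exact: finite_seq.
  - exact: (sub_trivIset _ live_disj).
  - by move=> w _; exact: measurable_live.
rewrite (_ : \bigcup_w live w = \bigcup_n F n); last first.
  apply/seteqP; split => o [].
    by move=> w _ lw; exists (size w) => //; exists w => //=; rewrite mem_words.
  by move=> n _ [w _ lw]; exists w.
rewrite measure_bigcup//; last first.
  apply/trivIsetP => n m _ _ nm; rewrite -subset0 => o [[w /= wn lw] [v /= vm lv]].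
  move: nm; rewrite mem_words in wn; rewrite mem_words in vm.
  rewrite -(eqP wn) -(eqP vm) => /eqP; apply; congr size.
  by case: lw lv => [lw _ aw] [lv _ av]; exact: alive_uniq lw lv aw av.
rewrite (eq_eseriesl (Q := xpredT)); last by move=> n; rewrite in_setT.
transitivity (\sum_(0 <= n <oo) \sum_(w <- words n) P (live w))%E.
  by apply: eq_eseriesr => n _; exact: PF.
have p0 n : (0 <= \sum_(w <- words n) P (live w))%E by apply: sume_ge0.
apply/eqP; rewrite eq_le; apply/andP; split.
  apply: lime_le; first by apply: is_cvg_nneseries => n _ _; exact: p0.
  apply: nearW => n; rewrite -(partial_sum n) leeDl//.
  by apply: sume_ge0 => w _; exact: hval_ge0.
(* For the lower bound the remainder, at most [expR t * rho ^+ n], is made smaller than [e]. *)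
apply/lee_addgt0Pr => e e0.
have [n ne] : exists n, expR t * rho ^+ n < e.
  have : expR t * rho ^+ n @[n --> \oo] --> expR t * 0.
    by apply: cvgM; [exact: cvg_cst|apply: cvg_expr; rewrite ger0_norm].
  rewrite mulr0 => /cvgrPdist_lt/(_ e e0)[n _ /(_ n (leqnn n))/=].
  by rewrite sub0r normrN ger0_norm ?mulr_ge0 ?expR_ge0 ?exprn_ge0// => ne; exists n.
rewrite -(partial_sum n); apply: leeD.
  by apply: nneseries_lim_ge => *; exact: p0.
by apply: le_trans (sum_hval_le n) _; rewrite lee_fin ltW.
Qed.

End mnw_recursion.

(** * The law of the index sets for the MNW tessellation *)

Section mnw_tessellation.
Variables (R : realType) (d : nat).
Notation V := 'rV[R]_d.+1.
Variables (W : set V) (x : nat -> V).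
Hypotheses (W_compact : compact W) (cW : segconvex W).
Hypothesis xW : forall i, W (x i).
Hypothesis xd : forall G, open G -> W `&` G !=set0 -> exists i, G (x i).
Variable Lambda : {measure set (hyp R d) -> \bar R}.
Hypothesis Lambda_lf : locally_finite_hyp Lambda.
Variables (dO : measure_display) (Omega : measurableType dO).
Variable P : probability Omega R.
Variables (L : seq bool -> Omega -> \bar R) (H : seq bool -> Omega -> hyp R d).
Hypothesis LH_mnw : is_mnw Lambda W P L H.
Variables (t : R) (t0 : 0 <= t).

Local Notation ocell := (mnw_open_cell W H).

Definition negative_lifetime : set Omega := \bigcup_w [set o | (L w o < 0)%E].

Let measurable_Lneg w : measurable [set o | (L w o < 0)%E].
Proof.
rewrite -[X in measurable X]setTI; apply: emeasurable_fun_infty_o => //.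
exact: (measurable_lifetime LH_mnw).
Qed.

Lemma measurable_negative_lifetime : measurable negative_lifetime.
Proof. exact: (countable_bigcupT_measurable (countableP _)). Qed.

Lemma P_negative_lifetime : P negative_lifetime = 0%E.
Proof.
apply/negligibleP; first exact: measurable_negative_lifetime.
pose F n := if unpickle n is Some w then [set o | (L w o < 0)%E] else set0.
rewrite (_ : negative_lifetime = \bigcup_n F n); last first.
  apply/seteqP; split => o [].
    by move=> w _ Lw; exists (pickle w) => //; rewrite /F pickleK.
  by move=> n _; rewrite /F; case: unpickle => // w Lw; exists w.
apply: negligible_bigcup => n; rewrite /F; case: unpickle => [w|]; last exact: negligible_set0.
apply/negligibleP; first exact: measurable_Lneg.
exact: lifetime_ge0 LH_mnw w.
Qed.

Lemma lifetimes_ge0 o : ~ negative_lifetime o -> forall w, (0 <= L w o)%E.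
Proof. by move=> No w; rewrite leNgt; apply/negP => Lw; apply: No; exists w. Qed.

(** Emptied on the null event of a negative lifetime, where cells alive at [t] might overlap; its
    cylinder events are then given by [live] exactly. *)
Definition same_live_cell i o : idxset :=
  [set j | ~ negative_lifetime o /\
           exists2 w, alive L t w o & ocell w o (x i) /\ ocell w o (x j)].

Let live_lineage Z w o : ~ negative_lifetime o -> Z `<=` ocell w o -> lineage L H Z w o.
Proof. by move=> /lifetimes_ge0 L0; exact: open_cell_lineage. Qed.

Let same_live_word w v o y : ~ negative_lifetime o -> alive L t w o -> alive L t v o ->
  ocell w o y -> ocell v o y -> w = v.
Proof.
move=> No aw av wy vy; apply: (@alive_uniq _ _ _ _ L H t [set y]) aw av.
- by exists y.
- by apply: live_lineage => // _ ->.
- by apply: live_lineage => // _ ->.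
Qed.

Lemma same_live_cell_cylinder i J : J != [::] ->
  same_live_cell i @^-1` cylinder J =
  (\bigcup_w live x L H t i J w) `\` negative_lifetime.
Proof.
move=> J0; apply/seteqP; split => o.
  move=> h; have [j jJ [No [w aw [wi _]]]] : exists2 j, j \in J & same_live_cell i o j.
    by case: J J0 h => // j J _ h; exists j; [|apply: h]; exact: mem_head.
  split => //; exists w => //; split => //; last exact: lifetimes_ge0.
  apply: live_lineage => // _ [k /= kJ <-].
  move: kJ; rewrite inE => /orP[/eqP ->//|kJ].
  (* The word found for [k] is the one found for [j], because both live cells contain [x i]. *)
  have [_ [v av [vi vk]]] := h k kJ.
  by rewrite (same_live_word No aw av wi vi).
move=> [[w _ [lw Lw aw]] No] j jJ; split => //; exists w => //.
have ZW : [set x k | k in [set k | k \in i :: J]] `<=` W by move=> _ [k _ <-].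
have wZ := lineage_open_cell ZW lw.
split; apply: wZ; first by exists i => //=; exact: mem_head.
by exists j => //=; rewrite inE jJ orbT.
Qed.

Let measurable_live_union i J : measurable (\bigcup_w live x L H t i J w).
Proof.
apply: (countable_bigcupT_measurable (countableP _)) => w.
exact: (measurable_live x LH_mnw).
Qed.

Lemma measurable_same_live_cell i : measurable_fun setT (same_live_cell i).
Proof.
apply: measurable_fun_idxset => J; have [->|J0] := eqVneq J [::].
  by rewrite (_ : _ @^-1` _ = setT); [exact: measurableT|apply/seteqP; split].
rewrite same_live_cell_cylinder//; apply: measurableD => //.
exact: measurable_negative_lifetime.
Qed.

Lemma same_live_cell_law i J : J != [::] ->
  P (same_live_cell i @^-1` cylinder J) =
  (expR (- (t * fine (Lambda (hit (star x i J))))))%:E.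
Proof.
move=> J0; rewrite same_live_cell_cylinder//.
rewrite -(P_live_union W_compact cW xW xd Lambda_lf LH_mnw i J t0).
have mU := measurable_live_union i J.
have mN := measurable_negative_lifetime.
rewrite [RHS](measureDI P mU mN) [X in (_ + X)%E](_ : _ = 0%E) ?adde0//.
apply/eqP; rewrite -measure_le0 -P_negative_lifetime.
by apply: le_measure; rewrite ?inE//; exact: measurableI.
Qed.

Lemma mean_mnw_cells B : measurable B ->
  mean_cell_measure P (mnw_cells W L H t) (B `&` cell_space W) =
  (\sum_(i <oo) P (same_live_cell i @^-1` (least_index i `&` closed_hull x @^-1` B)))%E.
Proof.
have clW : closed W by apply: compact_closed => //; exact: norm_hausdorff.
apply: (@mean_cell_measureE _ _ W x clW cW xW xd _ _ _ _
  (fun o => [set ocell w o | w in [set w | alive L t w o]]) _ negative_lifetime).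
- exact: measurable_negative_lifetime.
- exact: P_negative_lifetime.
- exact: measurable_same_live_cell.
move=> o No; split.
- by move=> _ [w _ <-]; exact: is_open_cell_mnw.
- move=> _ _ [w /= aw <-] [v /= av <-] [y [wy vy]].
  by rewrite (same_live_word No aw av wy vy).
- apply/seteqP; split => c [c0].
    move=> [w [cw bw tw]]; split => //; exists (ocell w o); first by exists w.
    by rewrite cw mnw_cellE.
  move=> [_ [w [bw tw] <-] cw]; split => //; exists w; split => //.
  by rewrite cw mnw_cellE.
- move=> i; apply/seteqP; split => j.
    by move=> [_ [w aw wij]]; exists (ocell w o) => //; exists w.
  by move=> [_ [w aw <-] wij]; split => //; exists w.
Qed.

End mnw_tessellation.

Theorem theorem1 (R : realType) (d : nat) (W : set 'rV[R]_d.+1)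
  (W_compact : compact W) (W_convex : convex_set W)
  (Lambda : {measure set (hyp R d) -> \bar R})
  (Lambda_lf : locally_finite_hyp Lambda) (Lambda_na : non_atomic Lambda)
  (t : R) (t_gt0 : 0 < t)
  (* Y(t, W) *)
  (d1 : measure_display) (Omega1 : measurableType d1)
  (P1 : probability Omega1 R)
  (L : seq bool -> Omega1 -> \bar R) (H : seq bool -> Omega1 -> hyp R d)
  (LH_mnw : is_mnw Lambda W P1 L H)
  (* PHT(t Lambda, W) *)
  (d2 : measure_display) (Omega2 : measurableType d2)
  (P2 : probability Omega2 R)
  (eta : Omega2 -> set (hyp R d))
  (eta_poisson : is_poisson_process P2 eta (mscale (NngNum (ltW t_gt0)) Lambda)) :
  forall B : set (fell 'rV[R]_d.+1),
    strace measurable (cell_space W) B ->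
    mean_cell_measure P1 (mnw_cells W L H t) B =
    mean_cell_measure P2 (pht_cells W eta) B.
Proof.
have cW := convex_set_segconvex W_convex.
(* An empty window has no dense sequence; neither tessellation then has any cell. *)
move=> _ [B mB <-]; have [->|/set0P/dense_seq_ex[x [xW xd]]] := eqVneq W set0.
  have mnw0 o : mnw_cells set0 L H t o = set0.
    rewrite -subset0 => c [[z cz] [w [cw _ _]]]; move: cz; rewrite cw.
    have -> : mnw_cell set0 H w o = set0; last by [].
    elim: w {cw} => //= b w ->.
    by rewrite /subcell set0I closure0.
  have pht0 o : pht_cells set0 eta o = set0.
    by rewrite -subset0 => c [z [[]]].
  rewrite /mean_cell_measure; under eq_integral do rewrite mnw0 esum_set0.
  under [RHS]eq_integral do rewrite pht0 esum_set0.
  by rewrite !integral0.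
rewrite (mean_mnw_cells W_compact cW xW xd Lambda_lf LH_mnw)//.
rewrite (mean_pht_cells W_compact cW xW xd Lambda_lf eta_poisson)//.
apply: eq_eseriesr => i _.
have mS1 := measurable_same_live_cell xW LH_mnw t i.
have mS2 := measurable_unseparated_from x eta_poisson i.
apply: (idxset_law mS1 mS2) => [J|].
  (* The star formula needs a nonempty [J]; for the empty one both probabilities are 1. *)
  have [->|J0] := eqVneq J [::].
    have cT : cylinder [::] = setT by apply/seteqP; split.
    by rewrite cT !preimage_setT !probability_setT.
  rewrite (same_live_cell_law W_compact cW xW xd Lambda_lf LH_mnw (ltW t_gt0))//.
  by rewrite (unseparated_from_law W_compact cW xW Lambda_lf eta_poisson).
apply: measurableI; first exact: measurable_least_index.
by rewrite -[X in measurable X]setTI; exact: measurable_closed_hull.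
Qed.
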